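(* Let $I$ be an island that has a path $abcd$ on the boundary of its infinite face, where the vertices $b$ and $c$ have degree $2$ in $I$. Let $J$ be the island obtained from $I$ by contracting the edge $bc$. Suppose that $I$ is reducible, and that in case $I$ is (only) C-reducible, it is C-reducible with respect to a contraction set $X$ that does not contain both $ab$ and $cd$ and such that $bc$ is not an isolated edge after deleting $X$. Then $J$ is also reducible.
   Context: An island is a $2$-connected plane graph in which every vertex has degree $2$ or $3$ and every vertex of degree $2$ is incident with the infinite face. Attach a new pendant edge to each degree-2 vertex; the set $R$ of these $k$ new edges is the ring, numbered $1,\dots,k$ in cyclic order around the infinite face. A coloring is a map $\kappa:\{1,\dots,k\}\to\{0,1,2\}$; it satisfies parity if $|\kappa^{-1}(0)|\equiv|\kappa^{-1}(1)|\equiv|\kappa^{-1}(2)|\pmod 2$. A match is an unordered pair $\{a,b\}$ of distinct elements of $\{1,\dots,k\}$; matches $\{a,b\},\{c,d\}$ with $a<c<b<d$ overlap. A signed match is a pair $(m,\mu)$ with $m$ a match and $\mu=\pm1$. A projective signed matching is a set $M$ of signed matches with pairwise disjoint matches such that the set $A$ of its matches can be partitioned as $A_0\cup A_1$ where matches in $A_0$ overlap no other match of $A$ and any two matches in $A_1$ overlap; $E(M)$ is the union of its matches. For $\theta\in\{0,1,2\}$, a parity coloring $\kappa$ $\theta$-fits $M$ if $E(M)=\{e:\kappa(e)\neq\theta\}$ and for each $(\{e,f\},\mu)\in M$, $\kappa(e)=\kappa(f)$ iff $\mu=1$. A set $\mathscr{C}$ of parity colorings is consistent if for every $\kappa\in\mathscr{C}$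 and every $\theta$ there is a projective signed matching $M$ that $\kappa$ $\theta$-fits such that $\mathscr{C}$ contains every coloring that $\theta$-fits $M$. Let $\mathscr{C}^*$ be all parity colorings, $\mathscr{C}_0$ the restrictions to $R$ of proper $3$-edge-colorings of $I\cup R$, and $\mathscr{C}'$ the maximal consistent subset of $\mathscr{C}^*\setminus\mathscr{C}_0$. $I$ is D-reducible if $\mathscr{C}'=\emptyset$. For $X\subseteq E(I)$ such that all endpoints of edges of $X$ have degree $3$ and no vertex is incident with exactly two edges of $X$, let $I'$ be obtained from $I$ by deleting $X$ and suppressing resulting degree-2 vertices where possible, and let $\mathscr{D}$ be the restrictions to $R$ of proper $3$-edge-colorings of $I'\cup R$; $I$ is C-reducible (with contraction set $X$) if $\mathscr{D}\cap\mathscr{C}'=\emptyset$. An island is reducible if it is D-reducible or C-reducible. *)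

(* Defs.v *)
From mathcomp Require Import all_boot.

Set Implicit Arguments.
Unset Strict Implicit.
Unset Printing Implicit Defensive.

(** * Colorings of a ring with [k] edges, numbered by ['I_k] *)

Section Ring.

Variable k : nat.

Definition coloring := {ffun 'I_k -> 'I_3}.

Definition parity (kappa : coloring) : bool :=
  [forall a : 'I_3, forall b : 'I_3,
     odd #|[set e | kappa e == a]| == odd #|[set e | kappa e == b]|].

Definition is_match (m : {set 'I_k}) : bool := #|m| == 2.

Definition overlap (m m' : {set 'I_k}) : bool :=
  [exists a : 'I_k, exists b : 'I_k, exists c : 'I_k, exists d : 'I_k,
     [&& a < c, c < b, b < d &
        (m == [set a; b]) && (m' == [set c; d])
        || (m' == [set a; b]) && (m == [set c; d])]].

(** The sign [+1] is [true] and the sign [-1] is [false]. *)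
Definition signed_match : finType := ({set 'I_k} * bool)%type.

Definition matches (M : {set signed_match}) : {set {set 'I_k}} :=
  [set p.1 | p in M].

Definition projective (M : {set signed_match}) : bool :=
  [&& [forall p in M, is_match p.1],
      [forall p in M, forall q in M, (p != q) ==> [disjoint p.1 & q.1]] &
      [exists A0 : {set {set 'I_k}}, exists A1 : {set {set 'I_k}},
        [&& A0 :|: A1 == matches M, [disjoint A0 & A1],
            [forall m in A0, forall m' in matches M,
               (m' != m) ==> ~~ overlap m m'] &
            [forall m in A1, forall m' in A1, (m != m') ==> overlap m m']]]].

(** [E(M)] *)
Definition ends (M : {set signed_match}) : {set 'I_k} :=
  \bigcup_(p in M) p.1.

Definition fits (theta : 'I_3) (kappa : coloring) (M : {set signed_match}) :
    bool :=
  [&& parity kappa,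
      ends M == [set e | kappa e != theta] &
      [forall p in M, forall e, forall f,
         (p.1 == [set e; f]) ==> ((kappa e == kappa f) == p.2)]].

(** [C^*] *)
Definition parity_colorings : {set coloring} := [set kappa | parity kappa].

Definition consistent (C : {set coloring}) : bool :=
  (C \subset parity_colorings) &&
  [forall kappa in C, forall theta : 'I_3,
     exists M : {set signed_match},
       [&& projective M, fits theta kappa M &
           [forall kappa', fits theta kappa' M ==> (kappa' \in C)]]].

(** The maximal consistent subset of [C^* \ C0]: a union of consistent sets is
    consistent, so this union is the maximal one, see [max_consistentP]. *)
Definition max_consistent (C0 : {set coloring}) : {set coloring} :=
  \bigcup_(C : {set coloring} |
             consistent C && (C \subset parity_colorings :\: C0)) C.

Lemma max_consistentP (C0 : {set coloring}) :
  [/\ consistent (max_consistent C0),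
      max_consistent C0 \subset parity_colorings :\: C0 &
      forall C, consistent C -> C \subset parity_colorings :\: C0 ->
        C \subset max_consistent C0].
Proof.
have sub : max_consistent C0 \subset parity_colorings :\: C0.
  by apply/bigcupsP => C /andP[].
have max C : consistent C -> C \subset parity_colorings :\: C0 ->
    C \subset max_consistent C0.
  by move=> cC sC; apply: (bigcup_sup C); rewrite cC.
split=> //; apply/andP; split; first exact: subset_trans sub (subsetDl _ _).
apply/forall_inP => kappa /bigcupP[C /andP[cC sC] kC]; apply/forallP => theta.
have /andP[_ /forall_inP/(_ _ kC)/forallP/(_ theta)/existsP[M]] := cC.
case/and3P=> pM fM /forallP hM; apply/existsP; exists M; rewrite pM fM /=.
apply/forallP => kappa'; apply/implyP => f'.
by apply: (subsetP (max _ cC sC)); move/implyP: (hM kappa') => ->.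
Qed.

End Ring.

(** * Plane graphs

    A graph embedded in an oriented surface is given by its darts (edges with a
    direction): [edge] reverses a dart and [node] maps a dart to the next one
    around its initial vertex.  Vertices, edges and faces are the orbits of
    [node], [edge] and [face], and an edge set is a set of darts closed under
    [edge].  The axioms on the two functions are part of [plane_graph] below;
    parallel edges are allowed. *)

Record gmap := Gmap {
  dart :> finType;
  edge : dart -> dart;
  node : dart -> dart
}.

Arguments edge {g}.
Arguments node {g}.

(** [face y] follows [y] on the boundary walk of the face beside it. *)
Definition face (G : gmap) (y : G) : G := node (edge y).

Definition vertex (G : gmap) (y : G) : {set G} := [set z | fconnect node y z].

Definition degree (G : gmap) (y : G) : nat := #|vertex y|.

Definition connected (G : gmap) : Prop :=
  forall y z : G,
    connect [rel s t | (t == edge s) || (t == node s)] y z.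

(** Genus 0 is expressed by Euler's formula [V - E + F = 2]. *)
Definition plane_graph (G : gmap) : Prop :=
  [/\ involutive (@edge G) /\ (forall y : G, edge y != y),
      injective (@node G),
      connected G &
      fcard node G + fcard (@face G) G = fcard edge G + 2].

(** More than two vertices, and no vertex [v] (given by one of its darts) whose
    deletion disconnects the graph. *)
Definition two_connected (G : gmap) : Prop :=
  [/\ 2 < fcard node G,
      connected G &
      forall v y z : G, y \notin vertex v -> z \notin vertex v ->
        connect [rel s t | [&& s \notin vertex v, t \notin vertex v &
                               (t == edge s) || (t == node s)]] y z].

(** The infinite face is the one containing the dart [o]. *)
Definition island (G : gmap) (o : G) : Prop :=
  [/\ plane_graph G, two_connected G,
      forall y : G, (degree y == 2) || (degree y == 3) &
      forall y : G, degree y = 2 ->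
        exists2 z, z \in vertex y & fconnect (@face G) o z].

(** * The ring

    The ring edges are represented by the darts of the infinite face that
    start at a vertex of degree 2, listed along this face from [o] on.  In an
    island every vertex of degree 2 occurs exactly once. *)

Definition ring (G : gmap) (o : G) : seq G :=
  [seq y <- orbit (@face G) o | degree y == 2].

Notation ring_coloring o := (coloring (size (ring o))).

Definition ring_dart (G : gmap) (o : G) (i : 'I_(size (ring o))) : G :=
  tnth (in_tuple (ring o)) i.

(** The restrictions to the ring of the proper 3-edge-colorings of [H] with the
    ring attached, where [H] is a graph given by its set of darts (still grouped
    into vertices by [vertex]) and by the relation [same] of belonging to the
    same edge. *)
Definition restrictions (G : gmap) (o : G) (H : {set G}) (same : rel G) :
    {set ring_coloring o} :=
  [set kappa : ring_coloring o | [exists c : {ffun G -> 'I_3},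
     [&& [forall y in H, forall z in H, same y z ==> (c y == c z)],
         [forall y in H, forall z in H,
            (z != y) && (z \in vertex y) ==> (c y != c z)] &
         [forall i, forall y in H,
            (y \in vertex (ring_dart i)) ==> (c y != kappa i)]]]].

(** [C_0] *)
Definition extendable (G : gmap) (o : G) : {set ring_coloring o} :=
  restrictions o setT [rel y z | z == edge y].

(** [C'] *)
Definition critical (G : gmap) (o : G) : {set ring_coloring o} :=
  max_consistent (extendable o).

Definition D_reducible (G : gmap) (o : G) : Prop := critical o = set0.

(** * Contraction sets *)

(** [X] must be nonempty: for [X = set0] the graph [I'] is [I] itself, and every
    island would be C-reducible. *)
Definition contraction_set (G : gmap) (X : {set G}) : Prop :=
  [/\ X != set0,
      forall y, (edge y \in X) = (y \in X),
      forall y, y \in X -> degree y = 3 &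
      forall v, #|vertex v :&: X| != 2].

(** The vertex of [y] gets degree 2 by the deletion of [X]. *)
Definition suppressed (G : gmap) (X : {set G}) (y : G) : bool :=
  (vertex y :&: X != set0) && (#|vertex y :\: X| == 2).

(** The graph [I']: its darts are those outside [X] at the vertices that are not
    suppressed, and its edges are the maximal chains of edges outside [X] glued
    at suppressed vertices.  So a chain closing up at a vertex of degree 3 gives
    a loop, which no proper coloring admits, and a cycle all of whose vertices
    are suppressed puts no condition on the colorings. *)
Definition reduced_darts (G : gmap) (X : {set G}) : {set G} :=
  [set y | (y \notin X) && ~~ suppressed X y].

Definition reduced_same (G : gmap) (X : {set G}) : rel G :=
  connect [rel y z | [&& y \notin X, z \notin X &
                        (z == edge y) || suppressed X y && (z \in vertex y)]].

Definition C_reducible_with (G : gmap) (o : G) (X : {set G}) : Prop :=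
  contraction_set X /\
  restrictions o (reduced_darts X) (reduced_same X) :&: critical o = set0.

Definition C_reducible (G : gmap) (o : G) : Prop :=
  exists X : {set G}, C_reducible_with o X.

Definition reducible (G : gmap) (o : G) : Prop :=
  D_reducible o \/ C_reducible o.

(** The edge of [x] remains when [X] is deleted and no other remaining edge
    meets it. *)
Definition isolated_after (G : gmap) (X : {set G}) (x : G) : Prop :=
  x \notin X /\
  forall y, y \in vertex x :|: vertex (edge x) -> y \notin X ->
    y = x \/ y = edge x.

(** * Contracting an edge

    The darts [x] and [edge x] disappear and the rotations around the two ends
    are merged.  The definition is meaningful when the edge is not a loop and
    both ends have degree at least 2; [insubd] then never uses its default. *)

Definition contract (G : gmap) (x : G) : gmap :=
  @Gmap {y : G | (y != x) && (y != edge x)}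
    (fun y => insubd y (edge (val y)))
    (fun y => insubd y (let z := node (val y) in
                        if z == x then node (edge x)
                        else if z == edge x then node x else z)).

Definition contract_dart (G : gmap) (x : G) (y : contract x) : G := val y.

(* Main.v *)
(** Let [b] and [c] also denote the ring edges at the two vertices of degree 2
    of [I], and [v] the ring edge of [J] that replaces them.  A coloring [kappa]
    of the ring of [I] with [kappa b <> kappa c] induces a coloring of the ring
    of [J], in which [v] gets the third color.  The colorings whose induced
    coloring is in [C'(J)] form a consistent set: if [v] has color [theta], then
    the match [{b, c}] with sign -1 is added, and it overlaps no match since
    [b] and [c] are consecutive; otherwise one of [b], [c] has color [theta], and
    the other one replaces [v] in its match, with the opposite sign.  An extension
    of [kappa] to [I] is also an extension of the induced coloring to [J], so these
    colorings are in [C'(I)].  Conversely an extension to [J'] of a coloring of the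
    ring of [J], where the edges [ab] and [cd] have colors [x] and [y], extends to
    [I'] by giving [bc] the color of [v], and [b] and [c] the colors [y] and [x].
    So [C'(I)], or its intersection with the restrictions from [I'], is nonempty
    if this holds for [J].

    A contraction set never meets [ab], [bc] and [cd], since [b] and [c] have
    degree 2.  Each vertex of degree 2 occurs only once on the infinite face since,
    by Euler's inequality for pairs of permutations, an edge with the same face on
    both sides is a bridge. *)

Require Import Defs.
From mathcomp Require Import all_boot fingroup perm zify.

Set Implicit Arguments.
Unset Strict Implicit.
Unset Printing Implicit Defensive.

(** * Overlapping matches and consistent sets *)

(* For four distinct ring edges [{a, b}] and [{c, d}] overlap iff an odd number of
   these comparisons hold; this form is invariant under rotations, since two of
   the comparisons change when one of the edges wraps around. *)
Definition crossing n (a b c d : 'I_n) : bool :=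
  (a < c) (+) (b < c) (+) ((a < d) (+) (b < d)).

Lemma overlapC n (m m' : {set 'I_n}) : overlap m m' = overlap m' m.
Proof.
by do 4!apply: eq_existsb => ?; rewrite orbC.
Qed.

Lemma set2_inj (T : finType) (a b c d : T) :
  a != b -> [set a; b] = [set c; d] -> a = c /\ b = d \/ a = d /\ b = c.
Proof.
move=> nab E.
have: a \in [set c; d] by rewrite -E set21.
have: b \in [set c; d] by rewrite -E set22.
by case/set2P=> ?; case/set2P=> ?; subst; rewrite ?eqxx in nab; auto.
Qed.

(** [overlap] fixes the order of the ends inside each match, while [crossing] is symmetric in [a, b]
    and in [c, d]. Once both pairs are increasing, only the order of [a] and [c] remains to be
    distinguished. *)
Lemma overlapE n (a b c d : 'I_n) :
  uniq [:: a; b; c; d] -> overlap [set a; b] [set c; d] = crossing a b c d.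
Proof.
rewrite /= !inE !negb_or -!andbA andbT -!val_eqE /=.
case/andP=> nab /and5P[nac nad nbc nbd ncd]; rewrite /crossing.
apply/existsP/idP=> [[a1 /existsP[b1 /existsP[c1 /existsP[d1]]]]|].
  case/and4P=> h1 h2 h3 /orP[] /andP[/eqP e1 /eqP e2];
  case: (set2_inj _ e1) => // -[? ?]; case: (set2_inj _ e2) => // -[? ?]; subst; lia.
(* Exchanging the two ends of a match changes neither the set nor the parity. *)
wlog ltab : a b nab nac nad nbc nbd / a < b.
  move=> W; case: (ltngtP a b) => [lt|lt|E]; last by rewrite E eqxx in nab.
    exact: W.
  rewrite [[set a; b]]setUC; move=> H; apply: W => //; first by rewrite eq_sym.
  by move: H; do 4!case: (_ < _).
wlog ltcd : c d ncd nac nad nbc nbd / c < d.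
  move=> W; case: (ltngtP c d) => [lt|lt|E]; last by rewrite E eqxx in ncd.
    exact: W.
  rewrite [[set c; d]]setUC; move=> H; apply: W => //; first by rewrite eq_sym.
  by move: H; do 4!case: (_ < _).
move=> H; have [lac|lca] := ltnP a c.
  exists a; apply/existsP; exists b; apply/existsP; exists c; apply/existsP.
  exists d; rewrite !eqxx /=; lia.
exists c; apply/existsP; exists d; apply/existsP; exists a; apply/existsP.
exists b; rewrite !eqxx /= orbT; lia.
Qed.

(* [g] tells which elements wrap around when the cyclic order is cut elsewhere. *)
Definition cyclic_embedding m n (h : 'I_m -> 'I_n) : Prop :=
  injective h /\
  exists g : 'I_m -> bool,
    forall a c, a != c -> (h a < h c) = (a < c) (+) (g a (+) g c).

Lemma disjoint_set2 (T : finType) (a b c d : T) :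
  a != b -> c != d -> [disjoint [set a; b] & [set c; d]] ->
  uniq [:: a; b; c; d].
Proof.
move=> nab ncd; rewrite disjoint_subset => /subsetP D.
have := D a (set21 _ _); have := D b (set22 _ _).
by rewrite /= !inE !negb_or nab ncd => /andP[-> ->] /andP[-> ->].
Qed.

(** Each of the four ends occurs in two of the comparisons that make up [crossing], so its
    wrap-around bit [g] is added twice and cancels. *)
Lemma overlap_imset m n (h : 'I_m -> 'I_n) (x y : {set 'I_m}) :
  cyclic_embedding h -> is_match x -> is_match y -> [disjoint x & y] ->
  overlap (h @: x) (h @: y) = overlap x y.
Proof.
case=> hI [g hg] /cards2P[a [b [nab ->]]] /cards2P[c [d [ncd ->]]] D.
have U := disjoint_set2 nab ncd D.
rewrite !imsetU !imset_set1 !overlapE //; last by rewrite -(map_inj_uniq hI) in U.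
move: U; rewrite /= !inE !negb_or -!andbA => /andP[_ /and5P[nac nad nbc nbd _]].
rewrite /crossing !hg //.
by move: (a < c) (b < c) (a < d) (b < d) (g a) (g b) (g c) (g d) => [] [] [] [] [] [] [] [].
Qed.

(** * Projective signed matchings: adding a match, and transport along an embedding *)

Section Projective.

Variable n : nat.
Implicit Types M : {set signed_match n}.

Lemma projectiveP M :
  reflect [/\ forall p, p \in M -> is_match p.1,
      forall p q, p \in M -> q \in M -> p != q -> [disjoint p.1 & q.1] &
      exists A0 A1 : {set {set 'I_n}},
        [/\ A0 :|: A1 = matches M, [disjoint A0 & A1],
          forall m m', m \in A0 -> m' \in matches M -> m' != m -> ~~ overlap m m' &
          forall m m', m \in A1 -> m' \in A1 -> m != m' -> overlap m m']]
   (projective M).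
Proof.
apply: (iffP and3P) => -[h1 h2 h3]; split.
- exact/forall_inP.
- by move=> p q pM qM; apply/implyP; move/forall_inP/(_ _ pM)/forall_inP: h2; apply.
- case/existsP: h3 => A0 /existsP[A1 /and4P[/eqP e d h4 h5]]; exists A0, A1.
  split=> // m m' mA mA'; apply/implyP.
    by move/forall_inP/(_ _ mA)/forall_inP: h4; apply.
  by move/forall_inP/(_ _ mA)/forall_inP: h5; apply.
- exact/forall_inP.
- by do 2!apply/forall_inP=> ? ?; apply/implyP; apply: h2.
- case: h3 => A0 [A1 [e d h4 h5]]; apply/existsP; exists A0; apply/existsP; exists A1.
  rewrite e eqxx d /=.
  apply/andP; split; do 2!apply/forall_inP=> ? ?; apply/implyP; [exact: h4 | exact: h5].
Qed.

Lemma endsP M e : reflect (exists2 p, p \in M & e \in p.1) (e \in ends M).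
Proof. exact: bigcupP. Qed.

Lemma matches_disjoint M x y :
  projective M -> x \in matches M -> y \in matches M -> x != y ->
  [/\ is_match x, is_match y & [disjoint x & y]].
Proof.
case/projectiveP=> h1 h2 _ /imsetP[p pM ->] /imsetP[q qM ->] ne.
by split; [exact: h1 | exact: h1 | apply: h2 => //; apply: contraNneq ne => ->].
Qed.

(** The hypothesis with [eps] says that [b] and [c] are cyclically consecutive. The ends [u] and [v]
    of another match each contribute [eps] to the crossing parity with [b, c], so the sum is even
    and the new match can be put into [A0]. *)
Lemma projective_add M (b c : 'I_n) (mu eps : bool) :
  b != c -> (forall x, x != b -> x != c -> (x < b) (+) (x < c) = eps) ->
  b \notin ends M -> c \notin ends M -> projective M ->
  projective (([set b; c], mu) |: M).
Proof.
move=> nbc adj bM cM PM; have [h1 h2 [A0 [A1 [e d h4 h5]]]] := projectiveP _ PM.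
have disj p : p \in M -> [disjoint [set b; c] & p.1].
  move=> pM; rewrite disjoint_subset; apply/subsetP=> x /set2P[]->;
    [apply: contra bM|apply: contra cM] => xp; by apply/endsP; exists p.
have no x : x \in matches M -> ~~ overlap [set b; c] x.
  case/imsetP=> p pM ->; have := disj p pM.
  have /cards2P[u [v [nuv ->]]] := h1 p pM => D.
  have U := disjoint_set2 nbc nuv D; rewrite overlapE //.
  move: U; rewrite /= !inE !negb_or -!andbA -!val_eqE => /andP[_ /and5P[bu bv cu cv _]].
  have := adj u; have := adj v; rewrite -!val_eqE /crossing /=.
  rewrite ![_ == val b]eq_sym ![_ == val c]eq_sym bu bv cu cv => /(_ isT isT) a1 /(_ isT isT) a2.
  move: a1 a2; rewrite /= in bu bv cu cv *; lia.
have notin : [set b; c] \notin matches M.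
  apply/imsetP=> -[p pM E]; case/negP: bM; apply/endsP; exists p => //.
  by rewrite -E set21.
have mE : matches (([set b; c], mu) |: M) = [set b; c] |: matches M.
  by rewrite /matches imsetU1.
apply/projectiveP; split.
- by move=> p /setU1P[->|/h1//]; rewrite /is_match /= cards2 nbc.
- move=> p q /setU1P[->|pM] /setU1P[->|qM]; rewrite ?eqxx //.
  + by move=> _; apply: disj.
  + by move=> _; rewrite disjoint_sym; apply: disj.
  + exact: h2.
exists ([set b; c] |: A0), A1; split=> //.
- by rewrite mE -setUA e.
- rewrite disjoint_subset; apply/subsetP=> x /setU1P[->|x0]; rewrite inE.
    by apply: contra notin => x1; rewrite -e inE x1 orbT.
  by move: d; rewrite disjoint_subset => /subsetP/(_ x x0).
- rewrite mE => x y /setU1P[->|x0] /setU1P[->|yM]; rewrite ?eqxx //.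
  + by move=> _; apply: no.
  + by move=> _; rewrite overlapC; apply: no; rewrite -e inE x0.
  + exact: h4.
Qed.

End Projective.

(** The signs may be replaced by any [sg], since being projective depends on the matches only. This
    freedom serves the match whose end moves and whose sign must change. *)
Lemma projective_imset m n (h : 'I_m -> 'I_n) (sg : signed_match m -> bool)
    (M : {set signed_match m}) :
  cyclic_embedding h -> projective M ->
  projective [set (h @: p.1, sg p) | p : signed_match m in M].
Proof.
move=> hE PM; have [h1 h2 [A0 [A1 [e d h4 h5]]]] := projectiveP _ PM.
have hI := hE.1; have hII := imset_inj hI.
have disj (x y : {set 'I_m}) : [disjoint h @: x & h @: y] = [disjoint x & y].
  by rewrite -!setI_eq0 -imsetI ?imset_eq0 //; move=> *; apply: hI.
have mE : matches [set (h @: p.1, sg p) | p : signed_match m in M] =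
    (fun x : {set 'I_m} => h @: x) @: matches M.
  by rewrite /matches -!imset_comp.
have ov x y : x \in matches M -> y \in matches M -> x != y ->
    overlap (h @: x) (h @: y) = overlap x y.
  by move=> xM yM ne; have [] := matches_disjoint PM xM yM ne; apply: overlap_imset.
apply/projectiveP; split.
- by move=> _ /imsetP[p pM ->]; rewrite /is_match /= card_imset //; apply: h1.
- move=> _ _ /imsetP[p pM ->] /imsetP[q qM ->] ne /=; rewrite disj; apply: h2 => //.
  by apply: contraNneq ne => ->.
exists ((fun x : {set 'I_m} => h @: x) @: A0), ((fun x : {set 'I_m} => h @: x) @: A1); split.
- by rewrite mE -e imsetU.
- by move: d; rewrite -!setI_eq0 -imsetI; [by rewrite imset_eq0|by move=> x y _ _; apply: hII].
- rewrite mE => _ _ /imsetP[x x0 ->] /imsetP[y yM ->]; rewrite (inj_eq hII) => ne.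
  by rewrite ov ?h4 // -?e ?inE ?x0 // eq_sym.
- move=> _ _ /imsetP[x x0 ->] /imsetP[y yM ->]; rewrite (inj_eq hII) => ne.
  by rewrite ov ?h5 // -?e ?inE ?x0 ?yM ?orbT.
Qed.

(** With three colors the default is never reached. For [x = y] the value is one of the two other
    colors. *)
Definition third (x y : 'I_3) : 'I_3 := odflt x [pick z | (z != x) && (z != y)].

Lemma third_neq (x y : 'I_3) : (third x y != x) && (third x y != y).
Proof.
rewrite /third; case: pickP => //= h.
have := h (inord 0); have := h (inord 1); have := h (inord 2).
rewrite -!val_eqE /= !inordK //; have := ltn_ord x; have := ltn_ord y; lia.
Qed.

Lemma thirdE (x y z : 'I_3) : x != y -> z != x -> z != y -> third x y = z.
Proof.
have /andP[] := third_neq x y; move: (third x y) => w.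
rewrite -!val_eqE /= => ? ? ? ? ?; apply/val_inj => /=.
have := ltn_ord x; have := ltn_ord y; have := ltn_ord z; have := ltn_ord w; lia.
Qed.

Lemma thirdC (x y : 'I_3) : x != y -> third x y = third y x.
Proof. by move=> nxy; apply: thirdE => //; have /andP[] := third_neq y x. Qed.

(** * Splitting a ring edge into two consecutive ones *)

Section Split.

Variables (m n : nat).
Implicit Types (h : 'I_m -> 'I_n) (b : 'I_n).
Implicit Types (kappa : coloring n).

(* The new edges are [b] and [h i0], and the last condition says that they are
   cyclically consecutive. *)
Definition splits h b i0 : Prop :=
  [/\ cyclic_embedding h, forall i, h i != b,
      forall e, e != b -> exists i, e = h i &
      exists eps, forall x, x != b -> x != h i0 -> (x < b) (+) (x < h i0) = eps].

(** The other choice of the new edge: [i0] now goes to [b], and [h i0] is the edge that is left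
    out. *)
Definition swap h b i0 : 'I_m -> 'I_n := fun i => if i == i0 then b else h i.

Lemma ltn_flip (k : nat) (x y : 'I_k) : x != y -> (x < y) = ~~ (y < x).
Proof. by rewrite -val_eqE /=; lia. Qed.

(** Comparisons with [b] and with [h i0] differ by the constant [eps], which is absorbed by the
    wrap-around bit of [i0]. This makes the two new edges interchangeable. *)
Lemma splits_swap h b i0 : splits h b i0 -> splits (swap h b i0) (h i0) i0.
Proof.
case=> -[hI [g hg]] hb ho [eps ad].
have sI : injective (swap h b i0).
  move=> i j; rewrite /swap; case: (eqVneq i i0) => [->|ni]; case: (eqVneq j i0) => [->|nj] //.
  - by move=> E; move: (hb j); rewrite E eqxx.
  - by move=> E; move: (hb i); rewrite E eqxx.
  - exact: hI.
split.
- split=> //; exists (fun i => g i (+) ((i == i0) && eps)) => a c nac.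
  have hn x : x != i0 -> h x != h i0 by rewrite (inj_eq hI).
  rewrite /swap; have [E|na] := eqVneq a i0; have [F|nc] := eqVneq c i0; subst.
  + by rewrite eqxx in nac.
  + rewrite /= [_ < h c]ltn_flip; last by rewrite eq_sym hb.
    have /= := ad (h c) (hb _) (hn _ nc); have /= := hg i0 c nac.
    rewrite (@ltn_flip _ (h i0)); last by rewrite eq_sym hn.
    by clear ad; move: (h c < b) (h c < h i0) eps (i0 < c) (g i0) (g c) => [] [] [] [] [] [].
  + have /= := ad (h a) (hb _) (hn _ na); have /= := hg a i0 nac.
    by clear ad; move: (h a < b) (h a < h i0) eps (a < i0) (g i0) (g a) => [] [] [] [] [] [].
  + by rewrite !addbF hg.
- move=> i; rewrite /swap; case: (eqVneq i i0) => [_|ni]; first by rewrite eq_sym.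
  by rewrite (inj_eq hI).
- move=> e; have [->|/ho[i ->]] := eqVneq e b; first by exists i0; rewrite /swap eqxx.
  by rewrite (inj_eq hI) => ni; exists i; rewrite /swap (negPf ni).
- exists eps => x xh; rewrite /swap eqxx => xb.
  by rewrite addbC ad.
Qed.

Definition merge_ring h b i0 kappa : coloring m :=
  [ffun i => if i == i0 then third (kappa b) (kappa (h i0)) else kappa (h i)].

Lemma merge_swap h b i0 kappa : kappa b != kappa (h i0) ->
  merge_ring (swap h b i0) (h i0) i0 kappa = merge_ring h b i0 kappa.
Proof.
move=> ne; apply/ffunP=> i; rewrite !ffunE /swap eqxx.
by case: eqVneq => // _; rewrite thirdC // eq_sym.
Qed.

Lemma sum_splits h b i0 (F : 'I_n -> nat) : splits h b i0 ->
  \sum_e F e = F b + \sum_i F (h i).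
Proof.
case=> -[hI _] hb ho _; rewrite (bigD1 b) //=; congr (_ + _).
transitivity (\sum_(e in h @: [set: 'I_m]) F e).
  by apply: eq_bigl => e; apply/idP/imsetP=> [/ho[i ->]|[i _ ->]//]; exists i; rewrite ?inE.
rewrite big_imset /=; last by move=> ? ? _ _; apply: hI.
by apply: eq_bigl => i; rewrite inE.
Qed.

(** Two distinct colors are replaced by the third one: two color classes lose an element and one
    gains an element. So all three parities flip, and their equality is unaffected. *)
Lemma parity_merge h b i0 kappa : splits h b i0 -> kappa b != kappa (h i0) ->
  parity (merge_ring h b i0 kappa) = parity kappa.
Proof.
move=> S ne.
have oE a : odd #|[set e | kappa e == a]| = ~~ odd #|[set e | merge_ring h b i0 kappa e == a]|.
  have cE k (kp : coloring k) : #|[set e | kp e == a]| = \sum_e (kp e == a).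
    by rewrite -sum1dep_card big_mkcond /=; apply: eq_bigr => i _; case: eqP.
  rewrite !cE (sum_splits (fun e => kappa e == a : nat) S) (bigD1 i0) //=.
  rewrite [in RHS](bigD1 i0) //= ffunE eqxx addnA !oddD.
  rewrite [in RHS](eq_bigr (fun i => kappa (h i) == a : nat)); last first.
    by move=> i ni; rewrite ffunE (negPf ni).
  rewrite -addNb; congr (_ (+) _).
  have /andP[n1 n2] := third_neq (kappa b) (kappa (h i0)).
  have [<-|nb] := eqVneq (kappa b) a.
    by rewrite eq_sym (negPf ne) (negPf n1).
  have [<-|nc] := eqVneq (kappa (h i0)) a; first by rewrite (negPf n2).
  have -> : third (kappa b) (kappa (h i0)) = a by apply: thirdE; rewrite // eq_sym.
  by rewrite eqxx.
apply: eq_forallb => a; apply: eq_forallb => c; rewrite !oE.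
by do 2!case: (odd _).
Qed.

Lemma fitsP k (theta : 'I_3) (kp : coloring k) (M : {set signed_match k}) :
  reflect [/\ parity kp, forall e, (e \in ends M) = (kp e != theta) &
     forall p e f, p \in M -> p.1 = [set e; f] -> (kp e == kp f) = p.2]
   (fits theta kp M).
Proof.
apply: (iffP and3P) => -[h1 h2 h3]; split=> //.
- by move=> e; rewrite (eqP h2) inE.
- move=> p e f pM E; move/forall_inP/(_ p pM)/forallP/(_ e)/forallP/(_ f): h3.
  by rewrite E eqxx => /eqP.
- by apply/eqP/setP=> e; rewrite inE h2.
- apply/forall_inP=> p pM; do 2!apply/forallP=> ?; apply/implyP=> /eqP E.
  by rewrite (h3 _ _ _ pM E).
Qed.

Lemma set2_imset k l (h : 'I_k -> 'I_l) (A : {set 'I_k}) e f :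
  injective h -> is_match A -> h @: A = [set e; f] ->
  exists u v, [/\ u != v, A = [set u; v], e = h u & f = h v].
Proof.
move=> hI /cards2P[u [v [nuv ->]]]; rewrite imsetU !imset_set1.
case/(set2_inj _) => [|[]<- <-|[]<- <-]; rewrite ?(inj_eq hI) //.
  by exists u, v.
by exists v, u; rewrite eq_sym setUC.
Qed.

Lemma ends_imset h (sg : signed_match m -> bool) (M : {set signed_match m}) i :
  injective h -> (h i \in ends [set (h @: p.1, sg p) | p : signed_match m in M]) = (i \in ends M).
Proof.
move=> hI; apply/endsP/endsP=> [[_ /imsetP[p pM ->] /=]|[p pM ip]].
  by rewrite mem_imset // => ip; exists p.
by exists (h @: p.1, sg p); [exact: imset_f | rewrite /= mem_imset].
Qed.

Lemma ends_imset_notin h b (sg : signed_match m -> bool) (M : {set signed_match m}) :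
  (forall i, h i != b) -> b \notin ends [set (h @: p.1, sg p) | p : signed_match m in M].
Proof.
move=> hb; apply/endsP=> -[_ /imsetP[p pM ->] /imsetP[i _ E]].
by move: (hb i); rewrite -E eqxx.
Qed.

(* Case where the induced color of [i0] is [theta]: the two edges [i0] is split into
   have the two other colors, so they are matched with each other, with sign -1. *)
Lemma fits_merge_theta h b i0 (M : {set signed_match m}) kappa theta :
  splits h b i0 -> projective M -> i0 \notin ends M ->
  fits theta kappa (([set b; h i0], false) |:
                     [set (h @: p.1, p.2) | p : signed_match m in M]) =
  (kappa b != kappa (h i0)) && fits theta (merge_ring h b i0 kappa) M.
Proof.
move=> S PM i0M; have [[hI _] hb ho _] := S; have [h1 _ _] := projectiveP _ PM.
set N := [set _ | p in M].
have eN e : (e \in ends (([set b; h i0], false) |: N)) = (e \in [set b; h i0]) || (e \in ends N).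
  by rewrite /ends bigcup_setU big_set1 inE.
apply/fitsP/andP=> [[hp he hs]|[ne /fitsP[hp he hs]]].
  have ne : kappa b != kappa (h i0).
    by rewrite (hs ([set b; h i0], false)) // setU11.
  have bt : kappa b != theta by rewrite -he eN set21.
  have ct : kappa (h i0) != theta by rewrite -he eN set22.
  have tE : third (kappa b) (kappa (h i0)) = theta by apply: thirdE; rewrite // eq_sym.
  split=> //; apply/fitsP; split; first by rewrite (parity_merge S).
  - move=> i; rewrite ffunE; have [->|ni] := eqVneq i i0; first by rewrite tE eqxx (negPf i0M).
    by rewrite -he eN !inE (negPf (hb i)) (inj_eq hI) (negPf ni) ends_imset.
  - move=> p e f pM pE; have eM : e \in ends M by apply/endsP; exists p; rewrite // pE set21.
    have fM : f \in ends M by apply/endsP; exists p; rewrite // pE set22.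
    have nei : e != i0 by apply: contraNneq i0M => <-.
    have nfi : f != i0 by apply: contraNneq i0M => <-.
    rewrite !ffunE (negPf nei) (negPf nfi) (hs (h @: p.1, p.2)) //=.
      by apply/setU1P; right; apply: imset_f.
    by rewrite pE imsetU !imset_set1.
have tE : third (kappa b) (kappa (h i0)) = theta.
  by move: (he i0); rewrite ffunE eqxx (negPf i0M) => /esym/negbFE/eqP.
have /andP[bt ct] := third_neq (kappa b) (kappa (h i0)).
rewrite tE eq_sym in bt; rewrite tE eq_sym in ct.
split; first by rewrite -(parity_merge S).
- move=> e; rewrite eN !inE; have [->|eb] := eqVneq e b; first by rewrite bt.
  have [->|ec] := eqVneq e (h i0); first by rewrite ct.
  have [i E] := ho e eb; rewrite E (inj_eq hI) in ec *.
  by rewrite ends_imset // he ffunE (negPf ec).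
- move=> p e f /setU1P[->|/imsetP[q qM ->]] /=.
    have nbc : b != h i0 by rewrite eq_sym.
    by move=> E; case: (set2_inj nbc E) => -[<- <-]; apply/negbTE; rewrite // eq_sym.
  have qc : is_match q.1 by apply: h1.
  move/(set2_imset hI qc) => [u [v [nuv qE -> ->]]]; rewrite -(hs q u v) // !ffunE.
  have nui : u != i0.
    by apply: contraNneq i0M => <-; apply/endsP; exists q; rewrite // qE set21.
  have nvi : v != i0.
    by apply: contraNneq i0M => <-; apply/endsP; exists q; rewrite // qE set22.
  by rewrite (negPf nui) (negPf nvi).
Qed.

(* The ring edge [b] has color [theta]: the end [i0] of a match moves to
   [h i0], whose color is the other one different from [theta], so that the
   sign of this match changes. *)
Lemma fits_merge_neq h b i0 (M : {set signed_match m}) kappa theta :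
  splits h b i0 -> projective M -> i0 \in ends M ->
  fits theta kappa [set (h @: p.1, p.2 (+) (i0 \in p.1)) | p : signed_match m in M] =
  [&& kappa b == theta, kappa (h i0) != theta & fits theta (merge_ring h b i0 kappa) M].
Proof.
move=> S PM i0M; have [[hI _] hb ho _] := S; have [h1 _ _] := projectiveP _ PM.
set N := [set _ | p in M].
have bN : b \notin ends N by apply: ends_imset_notin.
have hN i : (h i \in ends N) = (i \in ends M) by apply: ends_imset.
have split_eq (bt : kappa b = theta) (ct : kappa (h i0) != theta) e f :
    e != f -> kappa (h e) != theta -> kappa (h f) != theta ->
    (merge_ring h b i0 kappa e == merge_ring h b i0 kappa f) =
    (kappa (h e) == kappa (h f)) (+) ((e == i0) || (f == i0)).
  move=> nef et ft; rewrite !ffunE.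
  have ne : kappa b != kappa (h i0) by rewrite bt eq_sym.
  have /andP[n1 n2] := third_neq (kappa b) (kappa (h i0)).
  (* As [b] has color [theta], the merged color and [kappa (h i0)] are the two colors other than
     [theta], so [x] equals exactly one of them. *)
  have flip x : x != theta -> (third (kappa b) (kappa (h i0)) == x) = ~~ (kappa (h i0) == x).
    move=> xt; have [<-|nx] := eqVneq (kappa (h i0)) x; first by rewrite (negPf n2).
    have -> : third (kappa b) (kappa (h i0)) = x.
      by apply: thirdE; rewrite // ?bt // eq_sym.
    by rewrite eqxx.
  have [E|ei] := eqVneq e i0; have [F|fi] := eqVneq f i0.
  - by rewrite E F eqxx in nef.
  - by rewrite flip // E /= addbT.
  - by rewrite eq_sym flip // F /= addbT eq_sym.
  - by rewrite /= addbF.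
have i0q (q : signed_match m) e f : q.1 = [set e; f] -> (i0 \in q.1) = (e == i0) || (f == i0).
  by move=> ->; rewrite !inE ![i0 == _]eq_sym.
apply/fitsP/and3P=> [[hp he hs]|[/eqP bt ct /fitsP[hp he hs]]].
  have bt : kappa b = theta by apply/eqP; rewrite -[_ == _]negbK -he.
  have ct : kappa (h i0) != theta by rewrite -he hN.
  have ne : kappa b != kappa (h i0) by rewrite bt eq_sym.
  split=> //; first by rewrite bt.
  apply/fitsP; split; first by rewrite (parity_merge S).
  - move=> i; rewrite ffunE; have [->|ni] := eqVneq i i0.
      by rewrite i0M -bt; have /andP[->] := third_neq (kappa b) (kappa (h i0)).
    by rewrite -he hN.
  - move=> p e f pM pE; have eM : e \in ends M by apply/endsP; exists p; rewrite // pE set21.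
    have fM : f \in ends M by apply/endsP; exists p; rewrite // pE set22.
    have nef : e != f.
      by apply: contraTneq (h1 _ pM) => E; rewrite /is_match pE E setUid cards1.
    rewrite split_eq -?he ?hN // -(i0q p) //.
    rewrite (hs (h @: p.1, p.2 (+) (i0 \in p.1))) ?addbK //; first exact: imset_f.
    by rewrite pE imsetU !imset_set1.
have ne : kappa b != kappa (h i0) by rewrite bt eq_sym.
have heN e : (e \in ends N) = (kappa e != theta).
  have [->|/ho[i ->]] := eqVneq e b; first by rewrite bt eqxx (negPf bN).
  rewrite hN; have [->|ni] := eqVneq i i0; first by rewrite i0M ct.
  by rewrite he ffunE (negPf ni).
split=> //; first by rewrite -(parity_merge S).
move=> p e f /imsetP[q qM ->] /=; have qc : is_match q.1 by apply: h1.
move/(set2_imset hI qc) => [u [v [nuv qE -> ->]]].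
have uM : u \in ends M by apply/endsP; exists q; rewrite // qE set21.
have vM : v \in ends M by apply/endsP; exists q; rewrite // qE set22.
have := hs q u v qM qE; rewrite split_eq -?heN ?hN // -(i0q q) // => <-.
by rewrite addbK.
Qed.

Theorem consistent_split h b i0 (C : {set coloring m}) :
  splits h b i0 -> consistent C ->
  consistent [set kappa : coloring n | (kappa b != kappa (h i0)) && (merge_ring h b i0 kappa \in C)].
Proof.
move=> S /andP[sub /forall_inP cC]; apply/andP; split.
  apply/subsetP=> kappa; rewrite !inE => /andP[ne kC].
  by rewrite -(parity_merge S ne); have := subsetP sub _ kC; rewrite inE.
apply/forall_inP=> kappa; rewrite inE => /andP[ne kC]; apply/forallP=> theta.
have /forallP/(_ theta)/existsP[M /and3P[PM fM /forallP hM]] := cC _ kC.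
have /fitsP[_ he _] := fM.
(* It is enough to find a matching [N] that [kappa] fits and such that every coloring fitting [N]
   induces one fitting [M]. *)
have use N : projective N ->
    (forall kappa', fits theta kappa' N ->
       kappa' b != kappa' (h i0) /\ fits theta (merge_ring h b i0 kappa') M) ->
    fits theta kappa N ->
    [exists N : {set signed_match n}, [&& projective N, fits theta kappa N &
      [forall kappa', fits theta kappa' N ==> (kappa' \in
        [set kappa : coloring n | (kappa b != kappa (h i0)) && (merge_ring h b i0 kappa \in C)])]]].
  move=> PN fN kN; apply/existsP; exists N; rewrite PN kN; apply/forallP=> kappa'.
  by apply/implyP=> /fN[ne' f']; rewrite inE ne' (implyP (hM _)).
have [[hI hg] hb ho [eps ad]] := S.
have [i0M|i0M] := boolP (i0 \in ends M); last first.
  apply: (use (([set b; h i0], false) |: [set (h @: p.1, p.2) | p : signed_match m in M])).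
  - apply: projective_add ad _ _ _; first by rewrite eq_sym.
    + exact: ends_imset_notin.
    + by rewrite ends_imset.
    + by apply: projective_imset.
  - by move=> kappa'; rewrite (fits_merge_theta _ _ S) // => /andP.
  - by rewrite (fits_merge_theta _ _ S) // ne.
have : merge_ring h b i0 kappa i0 != theta by rewrite -he.
rewrite ffunE eqxx => nt.
have [bt|bt] := eqVneq (kappa b) theta.
  apply: (use [set (h @: p.1, p.2 (+) (i0 \in p.1)) | p : signed_match m in M]).
  - exact: projective_imset.
  - move=> kappa'; rewrite (fits_merge_neq _ _ S) // => /and3P[/eqP-> ? ?].
    by rewrite eq_sym.
  - by rewrite (fits_merge_neq _ _ S) // bt eqxx fM andbT -bt eq_sym.
(* If neither new edge had color [theta], then the merged color would be [theta], which [nt]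
   excludes. *)
have ct : kappa (h i0) = theta.
  by apply: contraNeq nt => ct; rewrite (thirdE (z := theta)) // eq_sym.
(* Exchanging the two new edges leads back to the case where the left-out edge has color [theta]. *)
have S' := splits_swap S; have [E' _ _ _] := S'.
have sw : swap h b i0 i0 = b by rewrite /swap eqxx.
apply: (use [set (swap h b i0 @: p.1, p.2 (+) (i0 \in p.1)) | p : signed_match m in M]).
- exact: projective_imset.
- move=> kappa'; rewrite (fits_merge_neq _ _ S') // sw => /and3P[/eqP ct' bt' f'].
  by rewrite -merge_swap ?ct'.
- by rewrite (fits_merge_neq _ _ S') // sw ct eqxx bt merge_swap.
Qed.

(** The colorings that induce a member of [max_consistent B] form a consistent set by
    [consistent_split], and they avoid [A] because their merged colorings avoid [B]. Maximality then
    puts them into [max_consistent A]. *)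
Corollary max_consistent_split h b i0 (A : {set coloring n}) (B : {set coloring m}) kappa :
  splits h b i0 ->
  (forall kappa, kappa \in A -> kappa b != kappa (h i0) -> merge_ring h b i0 kappa \in B) ->
  kappa b != kappa (h i0) -> merge_ring h b i0 kappa \in max_consistent B ->
  kappa \in max_consistent A.
Proof.
move=> S AB ne kB; have [cB sB _] := max_consistentP B.
have [_ _ mA] := max_consistentP A; have cC := consistent_split S cB.
apply: (subsetP (mA _ cC _)); last by rewrite inE ne.
apply/subsetP=> kp kC; rewrite !inE; have := kC; rewrite inE => /andP[ne' kB'].
rewrite -(parity_merge S ne'); have := subsetP sB _ kB'; rewrite !inE => /andP[nB ->].
by rewrite andbT; apply: contra nB => kA; apply: AB.
Qed.

Lemma merge_onto h b i0 (kappa : coloring m) x y :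
  splits h b i0 -> third x y = kappa i0 ->
  exists kappa', [/\ kappa' b = x, kappa' (h i0) = y,
    forall i, i != i0 -> kappa' (h i) = kappa i & merge_ring h b i0 kappa' = kappa].
Proof.
case=> -[hI _] hb _ _ tE.
(* The [pick] inverts [h]. The default [i0] is not reached, since every edge other than [b] is in
   the image of [h]. *)
pose kappa' : coloring n := [ffun e => if e == b then x else if e == h i0 then y
  else kappa (odflt i0 [pick i | h i == e])].
have kb : kappa' b = x by rewrite ffunE eqxx.
have kc : kappa' (h i0) = y by rewrite ffunE (negPf (hb _)) eqxx.
have kh i : i != i0 -> kappa' (h i) = kappa i.
  move=> ni; rewrite ffunE (negPf (hb _)) (inj_eq hI) (negPf ni).
  by case: pickP => [k /eqP/hI->|/(_ i)] //; rewrite eqxx.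
exists kappa'; split=> //; apply/ffunP=> i; rewrite ffunE kb kc tE.
by case: eqVneq => [->|/kh].
Qed.

End Split.

(** * Cyclic order of rotated sequences *)

Lemma index_rot (T : eqType) (s : seq T) j u : uniq s -> u \in s ->
  index u (rot j s) =
  if index u s < j then index u s + (size s - j) else index u s - j.
Proof.
move=> us uS; set i := index u s; have ltis : i < size s by rewrite index_mem.
have E : nth u s i = u by apply: nth_index.
have [lt|le] := ltnP i j.
  have K : nth u (rot j s) (i + (size s - j)) = u.
    by rewrite /rot nth_cat size_drop ltnNge leq_addl /= addnK nth_take.
  rewrite -{1}K index_uniq ?rot_uniq // size_rot.
  have [lej|lej] := leqP j (size s); lia.
have K : nth u (rot j s) (i - j) = u.
  rewrite /rot nth_cat size_drop ltn_sub2r // ?nth_drop ?subnKC //.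
  exact: leq_ltn_trans ltis.
by rewrite -{1}K index_uniq ?rot_uniq // size_rot; lia.
Qed.

(** Entries with index below [j] are moved behind the others, so a comparison is reversed exactly
    when one of the two entries is moved and the other is not. *)
Lemma ltn_index_rot (T : eqType) (s : seq T) j u v :
  uniq s -> u \in s -> v \in s -> u != v ->
  (index u (rot j s) < index v (rot j s)) =
  (index u s < index v s) (+) ((index u s < j) (+) (index v s < j)).
Proof.
move=> us uS vS nuv; rewrite !index_rot //.
have : index u s != index v s.
  by apply: contraNneq nuv => E; rewrite -(nth_index u uS) E nth_index.
have : index u s < size s by rewrite index_mem.
have : index v s < size s by rewrite index_mem.
move: (index u s) (index v s) => a b; have [la|la] := ltnP a j; have [lb|lb] := ltnP b j; lia.
Qed.

(** Here [r] and [r'] stand for the rings of the two islands, each cut open at an arbitrary place.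
    Comparing positions in the unrotated lists, where [x] and [y] are adjacent, leaves only
    wrap-around bits. *)
Lemma rot_splits (T : eqType) (x y : T) (s r r' : seq T) j j' m n
    (h : 'I_m -> 'I_n) (b : 'I_n) (i0 : 'I_m) :
  size r = n -> size r' = m ->
  uniq (x :: y :: s) -> r = rot j (x :: y :: s) -> r' = rot j' (y :: s) ->
  (forall i, nth x r (h i) = nth x r' i) -> nth x r b = x -> nth x r' i0 = y ->
  splits h b i0.
Proof.
move=> rn r'm; subst m n; set S := x :: y :: s; set S' := y :: s => uS rE r'E hE bE iE.
have uS' : uniq S' by case/andP: uS.
have ur : uniq r by rewrite rE rot_uniq.
have ur' : uniq r' by rewrite r'E rot_uniq.
have xS' : x \notin S' by case/andP: uS.
have mr u : (u \in r) = (u \in S) by rewrite rE mem_rot.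
have mr' u : (u \in r') = (u \in S') by rewrite r'E mem_rot.
pose f (e : 'I_(size r)) := nth x r e; pose f' (i : 'I_(size r')) := nth x r' i.
have fr e : f e \in S by rewrite -mr mem_nth.
have fr' i : f' i \in S' by rewrite -mr' mem_nth.
have fI e e' : (f e == f e') = (e == e') by rewrite nth_uniq.
have fI' i i' : (f' i == f' i') = (i == i') by rewrite nth_uniq.
have fidx e : nat_of_ord e = index (f e) r by rewrite index_uniq.
have fidx' i : nat_of_ord i = index (f' i) r' by rewrite index_uniq.
have flt (e e' : 'I_(size r)) : e != e' -> (e < e') =
    (index (f e) S < index (f e') S) (+) ((index (f e) S < j) (+) (index (f e') S < j)).
  by move=> ne; rewrite !fidx rE ltn_index_rot ?fI.
have flt' (i k : 'I_(size r')) : i != k -> (i < k) =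
    (index (f' i) S' < index (f' k) S') (+) ((index (f' i) S' < j') (+) (index (f' k) S' < j')).
  by move=> ne; rewrite !fidx' r'E ltn_index_rot ?fI'.
have iS u : u \in S' -> index u S = (index u S').+1.
  by move=> uu; rewrite /S /=; case: eqP => // E; rewrite E uu in xS'.
have hI : injective h.
  by move=> i k E; apply/eqP; rewrite -fI' /f' -!hE E.
have fh i : f (h i) = f' i by apply: hE.
split.
- split=> //; exists (fun i => (index (f' i) S < j) (+) (index (f' i) S' < j')) => i k ne.
  rewrite flt ?(inj_eq hI) // flt' // !fh !iS //.
  rewrite ltnS; move: (_ < _) (_ < j) (_ < j') (_ < j) (_ < j').
  by do 5!case.
- move=> i; apply: contraNneq xS' => E; by move: (fr' i); rewrite -fh E /f bE.
- move=> e ne; have fS' : f e \in S'.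
    have := fr e; rewrite inE => /orP[|//]; rewrite -{1}bE fI => E.
    by rewrite E in ne.
  have ltk : index (f e) r' < size r' by rewrite index_mem mr'.
  exists (Ordinal ltk); apply/eqP; rewrite -fI fh /f' /= nth_index // mr'.
  by [].
(* In the unrotated list [x] and [y] come first, so no other entry precedes either of them. The
   wrap-around bit of [e] occurs twice and cancels, and those of [x] and [y] remain. *)
- exists ((index x S < j) (+) (index y S < j)) => e eb ei.
  have fb : f b = x by []; have f'i : f' i0 = y by []; rewrite !flt // fh fb f'i.
  have fx : x != f e by rewrite eq_sym -fb fI.
  have fy : y != f e by rewrite eq_sym -f'i -fh fI.
  have -> : index (f e) S < index x S = false by rewrite /S /= eqxx.
  have -> : index (f e) S < index y S = false.
    by rewrite /S /= (negPf fx) (negPf fy) eqxx; case: (x == y).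
  by case: (index (f e) S < j); case: (index x S < j); case: (index y S < j).
Qed.

Lemma filter_rot (T : Type) (p : pred T) (s : seq T) j :
  exists j', filter p (rot j s) = rot j' (filter p s).
Proof.
exists (size (filter p (take j s))).
by rewrite -{3}(cat_take_drop j s) !filter_cat rot_size_cat.
Qed.

(** * Euler's inequality *)

Section Euler.

Variable T : finType.
Implicit Types (s t : {perm T}) (R : {set T}).

(** Steps in both directions are allowed: the relation is symmetric, and its components are the
    orbits of the group generated by [s] and [t]. *)
Definition step s t : rel T :=
  [rel u v | [|| v == s u, u == s v, v == t u | u == t v]].

Lemma step_sym s t : connect_sym (step s t).
Proof.
apply: sym_connect_sym => u v /=.
by rewrite /step; rewrite /=; case: (v == s u); case: (u == s v); case: (v == t u); case: (u == t v).
Qed.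

Lemma connect_invariant (e : rel T) (P : T -> Prop) :
  (forall u v, P u -> e u v -> P v) -> forall u v, P u -> connect e u v -> P v.
Proof.
move=> cl u v Pu /connectP[p ep ->]; elim: p u Pu ep => //= w p IH u Pu /andP[uw].
exact/IH/(cl u).
Qed.

Lemma porbit_connect s (e : rel T) :
  (forall u, connect e u (s u)) -> forall u v, v \in porbit s u -> connect e u v.
Proof.
move=> es u v /porbitP[i ->]; elim: i => [|i IH]; first by rewrite expg0 perm1.
by rewrite expgSr permM; apply: connect_trans IH (es _).
Qed.

(* [R] meets each orbit of the group generated by [s] and [t].  Induction on the
   support of [s]: write [s] as a transposition of [x] and [y] times [s'], where
   [s'] fixes [x] and has one more cycle than [s].  The numbers of cycles of
   [s * t] and [s' * t] differ by one; if [x] and [y] lie in different orbits of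
   the group generated by [s'] and [t], then [s * t] has one cycle less and one
   more element in [R] is enough for [s'] and [t]. *)
Lemma euler_inequality s t R :
    (forall x, exists2 r, r \in R & connect (step s t) r x) ->
  #|porbits s| + #|porbits t| + #|porbits (s * t)%g| <= #|T| + 2 * #|R|.
Proof.
have [m] := ubnP #|[set x | s x != x]|; elim: m s R => // m IH s R ltm hR.
have [/existsP[x nsx]|] := boolP [exists x, s x != x]; last first.
  rewrite negb_exists => /forallP fx.
  have s1 : s = 1%g by apply/permP => x; rewrite perm1; apply/eqP; rewrite -[_ == _]negbK.
  rewrite {}s1 mul1g in hR *.
  (* For [s = 1] the components are the cycles of [t], each of which meets [R]. Both [t] and [s * t]
     have these cycles, which accounts for the term [2 * #|R|]. *)
  have: porbits t \subset [set porbit t x | x in R].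
    apply/subsetP=> _ /imsetP[x _ ->]; have [r rR cr] := hR x; apply/imsetP.
    exists r => //; apply/eqP; rewrite eq_porbit_mem.
    apply: (connect_invariant (P := fun v => v \in porbit t r) _ _ cr); last exact: porbit_id.
    move=> u v ur; rewrite /step /= !perm1 => /or4P[]/eqP E; rewrite ?E //.
    - by rewrite -E.
    - by move: ur; rewrite -!eq_porbit_mem => /eqP<-; rewrite -(porbit_perm t 1 u) expg1 eqxx.
    - by move: ur; rewrite E -!eq_porbit_mem => /eqP<-; rewrite -(porbit_perm t 1 v) expg1 eqxx.
  move/subset_leq_card/leq_trans/(_ (leq_imset_card _ _)).
  have: #|porbits (1 : {perm T})%g| <= #|T| by apply: leq_imset_card.
  by lia.
pose y := (s^-1)%g x; have sy : s y = x by rewrite permKV.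
have nxy : x != y by apply: contraNneq nsx => E; rewrite {1}E sy.
pose s' : {perm T} := (tperm x y * s)%g.
have sE : s = (tperm x y * s')%g by rewrite mulgA tperm2 mul1g.
have s'x : s' x = x by rewrite permM tpermL.
have s'D z : z != x -> z != y -> s' z = s z by move=> zx zy; rewrite permM tpermD // eq_sym.
have s'y : s' y = s x by rewrite permM tpermR.
have ltm' : #|[set z | s' z != z]| < m.
  rewrite -ltnS; apply: leq_trans ltm; rewrite ltnS; apply: proper_card.
  apply/properP; split; last by exists x; rewrite !inE ?s'x ?eqxx.
  apply/subsetP=> z; rewrite !inE; have [->|zx] := eqVneq z x; first by rewrite s'x eqxx.
  have [->|zy] := eqVneq z y; first by rewrite sy.
  by rewrite s'D.
have c1 : #|porbits s| + 1 = #|porbits s'|.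
  have /= := porbits_mul_tperm s' x y; rewrite -sE nxy.
  suff -> : x \notin porbit s' y by lia.
  rewrite porbit_sym; apply/porbitP=> -[i E]; move: nxy; rewrite E.
  suff -> : (s' ^+ i)%g x = x by rewrite eqxx.
  by elim: i {E} => [|i IHi]; rewrite ?expg0 ?perm1 // expgSr permM IHi.
have /= := porbits_mul_tperm (s' * t) x y; rewrite mulgA -sE nxy => c2.
pose e := step s' t.
have eS u : e u (s' u) by rewrite /e /step /= eqxx.
have eV u : e (s' u) u by rewrite /e /step /= eqxx orbT.
have eC : connect_sym e by apply: step_sym.
have et u : e u (t u) by rewrite /e /step /= eqxx !orbT.
have etV u : e (t u) u by rewrite /e /step /= eqxx !orbT.
(* A walk by [s] and [t] from [r] is also one by [s'] and [t] as long as it avoids [x] and [y], the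
   only points where [s] and [s'] differ. *)
pose P r v := [|| connect e r v, connect e r x | connect e r y].
have Pcl r u v : P r u -> step s t u v -> P r v.
  rewrite /P => /orP[ru|->]; last by rewrite orbT.
  have [ux|ux] := eqVneq u x; first by rewrite -ux ru !orbT.
  have [uy|uy] := eqVneq u y; first by rewrite -uy ru !orbT.
  case/or4P=> /eqP E.
  - by rewrite (connect_trans ru) // E -s'D // connect1.
  - have [vx|vx] := eqVneq v x.
      by rewrite E vx -s'y in ru; rewrite (connect_trans ru (connect1 (eV _))) !orbT.
    have [vy|vy] := eqVneq v y; first by rewrite E vy sy eqxx in ux.
    by rewrite E -s'D // in ru; rewrite (connect_trans ru (connect1 (eV _))).
  - by rewrite E (connect_trans ru (connect1 (et _))).
  - by rewrite E in ru; rewrite (connect_trans ru (connect1 (etV _))).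
have Pc r v : connect (step s t) r v -> P r v.
  by apply: (connect_invariant (P := P r)); [exact: Pcl | rewrite /P connect0].
(* If [x] and [y] are connected by [s'] and [t], then [R] still meets all components. Here [s] has
   one cycle less than [s'], and [s * t] has at most one more than [s' * t]. *)
have [cxy|nc] := boolP (connect e x y).
  have /IH : forall x0, exists2 r, r \in R & connect (step s' t) r x0.
    move=> v; have [r rR crv] := hR v; exists r => //.
    apply: (connect_invariant (P := connect e r) _ _ crv); last exact: connect0.
    move=> u w ru st.
    have : P u w by apply: Pcl st; rewrite /P connect0.
    have link : (connect e u x || connect e u y) -> connect e u x /\ connect e u y.
      case/orP=> c; split=> //; first exact: connect_trans cxy.
      by apply: connect_trans c _; rewrite eC.
    rewrite /P => /orP[|/link[cx cy]]; first exact: connect_trans.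
    have : P w u.
      apply: Pcl (_ : P w w) _; first by rewrite /P connect0.
      by move: st; rewrite /step /= => /or4P[]->; rewrite ?orbT.
    case/orP=> [|c]; first by rewrite eC; apply: connect_trans.
    apply: connect_trans (connect_trans ru cx) _; rewrite eC.
    case/orP: c => // cwy; apply: connect_trans cwy _; by rewrite eC.
  move/(_ ltm').
  have c2' : #|porbits (s * t)%g| <= #|porbits (s' * t)%g| + 1.
    by rewrite -c2 leq_addr.
  move: c2' c1; move: #|porbits s| #|porbits s'| #|porbits t|.
  by move: #|porbits (s * t)%g| #|porbits (s' * t)%g| #|T| #|R|; clear; lia.
have nin : x \notin porbit (s' * t) y.
  apply: contra nc => h; rewrite eC; apply: porbit_connect h => u.
  by rewrite permM (connect_trans (connect1 (eS _)) (connect1 (et _))).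
have [r0 r0R c0] := hR x.
(* The representative [r0] reaches one of [x] and [y] under [s'] and [t]; the other one is taken as
   the additional representative [z]. *)
have [z hz] : exists z, forall v, v \in [set x; y] -> connect e r0 v || connect e z v.
  have : connect e r0 x || connect e r0 y by move: (Pc _ _ c0); rewrite /P orbA orbb.
  by case/orP=> c; [exists y | exists x] => v /set2P[]->; rewrite ?c ?connect0 ?orbT.
have /IH : forall v, exists2 r, r \in z |: R & connect (step s' t) r v.
  move=> v; have [r rR crv] := hR v.
  have link w : w \in [set x; y] -> connect e w v ->
      exists2 r, r \in z |: R & connect (step s' t) r v.
    move=> /hz/orP[c1' c2'|c1' c2']; [exists r0|exists z]; rewrite ?inE ?r0R ?eqxx ?orbT //;
      exact: connect_trans c2'.
  case/orP: (Pc _ _ crv) => [c|c]; first by exists r => //; rewrite inE rR orbT.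
  have := Pc v r; rewrite /P eC (step_sym s t) => /(_ crv).
  case/or3P=> c'; first by exists r; rewrite // inE rR orbT.
    by apply: (link x); rewrite ?set21 // eC.
  by apply: (link y); rewrite ?set22 // eC.
move/(_ ltm'); have : #|z |: R| <= #|R| + 1 by rewrite cardsU1; lia.
move: c2 c1; rewrite nin /=; move: #|porbits s| #|porbits s'| #|porbits t|.
move: #|porbits (s * t)%g| #|porbits (s' * t)%g| #|T| #|R| #|z |: R|.
by clear; lia.
Qed.

Lemma porbits_fcard s : #|porbits s| = fcard s T.
Proof.
have pE x y : (y \in porbit s x) = fconnect s x y.
  apply/porbitP/idP=> [[i ->]|/iter_findex <-].
    by rewrite permX fconnect_iter.
  by exists (findex s x y); rewrite permX.
have symc := fconnect_sym (@perm_inj _ s).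
rewrite /n_comp_mem -(card_in_imset (f := porbit s)); last first.
  move=> x y; rewrite !inE !andbT => /eqP rx /eqP ry E.
  by rewrite -rx -ry; apply/eqP; rewrite root_connect // -pE E porbit_id.
apply: eq_card => A; apply/imsetP/imsetP=> -[x xR ->]; last by exists x.
exists (root (frel s) x); first by rewrite !inE andbT; apply: roots_root.
by apply/eqP; rewrite eq_porbit_mem pE symc connect_root.
Qed.

End Euler.

(* Cutting the edge of [x] would create one more edge orbit and one more face. *)
Lemma not_bridge (G : gmap) (x : G) : plane_graph G ->
  (forall y, connect [rel s t | (t == node s) ||
                         (s \notin [set x; edge x]) && (t == edge s)] x y) ->
  ~~ fconnect (@face G) x (edge x).
Proof.
case=> [[edgeK edgeN] nodeI _ euler] conn; apply/negP=> same.
pose pE : {perm G} := perm (inv_inj edgeK); pose pN : {perm G} := perm nodeI.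
(* This permutation fixes [x] and [edge x] and agrees with [edge] elsewhere: the edge is cut into
   two half-edges. *)
pose e' : {perm G} := (tperm x (edge x) * pE)%g.
have pF : (pE * pN)%g =1 @face G by move=> y; rewrite permM !permE.
have nE y : pN y = node y by rewrite permE.
have eE y : pE y = edge y by rewrite permE.
have cN : #|porbits pN| = fcard (@node G) G.
  by rewrite porbits_fcard; apply: eq_fcard => y; rewrite permE.
have cE : #|porbits pE| = fcard (@edge G) G.
  by rewrite porbits_fcard; apply: eq_fcard => y; rewrite permE.
have cF : #|porbits (pE * pN)%g| = fcard (@face G) G.
  by rewrite porbits_fcard; apply: eq_fcard.
have mE : x \in porbit pE (edge x).
  by rewrite porbit_sym; have := mem_porbit pE 1 x; rewrite expg1 permE.
have mF : x \in porbit (pE * pN)%g (edge x).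
  rewrite porbit_sym; move: same => /iter_findex <-; apply/porbitP.
  by exists (findex (@face G) x (edge x)); rewrite permX; apply/esym/eq_iter.
have nx : x != edge x by rewrite eq_sym.
have /= := porbits_mul_tperm pE x (edge x); rewrite mE nx addn0 -/e' => c1.
have /= := porbits_mul_tperm (pE * pN)%g x (edge x); rewrite mF nx addn0 mulgA -/e' => c2.
have /euler_inequality : forall y, exists2 r, r \in [set x] & connect (step e' pN) r y.
  move=> y; exists x; first exact: set11.
  apply: connect_sub (conn y) => s t /orP[/eqP->|/andP[]].
    by apply: connect1; rewrite /step /= nE eqxx !orbT.
  rewrite !inE negb_or => /andP[sx sex] /eqP->; apply: connect1.
  by rewrite /step /= permM tpermD 1?eq_sym // eE eqxx.
(* There are [2E] darts. After the cut, the inequality reads [V + (E + 1) + (F + 1) <= 2E + 2],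
   which contradicts [V + F = E + 2]. *)
have : fcard (@edge G) G * 2 = #|G|.
  apply: (fcard_order_set (inv_inj edgeK)); last by move=> ? ? _.
  apply/subsetP=> y _; rewrite inE /=.
  have /order_cycle : fcycle (@edge G) [:: y; edge y] by rewrite /= edgeK !eqxx.
  by move=> -> //; rewrite /= ?inE ?eqxx // eq_sym edgeN.
rewrite cards1; move: euler c1 c2; rewrite -cE -cN -cF.
move: #|porbits e'| #|porbits pE| #|porbits pN| #|porbits (e' * pN)%g|.
move: #|porbits (pE * pN)%g| #|G|.
by clear; lia.
Qed.

(** * Contracting [bc] *)

Lemma fconnect_closed (T : finType) (f : T -> T) (P : T -> Prop) x y :
  (forall z, P z -> P (f z)) -> P x -> fconnect f x y -> P y.
Proof. by move=> cl Px /iter_findex <-; elim: findex => //= n; apply: cl. Qed.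

(** * Vertices as orbits of [node] *)

Section Gmap.

Variable G : gmap.
Hypothesis nodeI : injective (@node G).

Lemma vertex_id (y : G) : y \in vertex y.
Proof. by rewrite inE connect0. Qed.

Lemma vertex_eq (y z : G) : z \in vertex y -> vertex z = vertex y.
Proof.
rewrite inE => yz; apply/setP=> t; rewrite !inE.
by apply: (same_connect (fconnect_sym nodeI)); rewrite fconnect_sym.
Qed.

Lemma vertex_node (y : G) : node y \in vertex y.
Proof. by rewrite inE fconnect1. Qed.

Lemma degree2_node (y : G) : degree y = 2 ->
  [/\ node (node y) = y, node y != y & vertex y = [set y; node y]].
Proof.
move=> d; have o2 : fingraph.order node y = 2 by rewrite -d /degree /vertex cardsE.
have nn : node (node y) = y by have := iter_order nodeI y; rewrite o2.
have vE : vertex y = [set y; node y].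
  apply/setP=> z; rewrite inE fconnect_orbit /orbit o2 /=.
  by rewrite !inE.
by split=> //; move: d; rewrite /degree vE cards2 eq_sym; case: (_ == _).
Qed.

End Gmap.

Lemma restrictionsP (G : gmap) (o : G) (H : {set G}) (same : rel G)
    (kappa : coloring (size (ring o))) :
  reflect (exists c : G -> 'I_3,
     [/\ forall y z, y \in H -> z \in H -> same y z -> c y = c z,
         forall y z, y \in H -> z \in H -> z != y -> z \in vertex y -> c y != c z &
         forall i y, y \in H -> y \in vertex (ring_dart i) -> c y != kappa i])
   (kappa \in restrictions o H same).
Proof.
rewrite inE; apply: (iffP existsP) => -[c].
  case/and3P=> /forall_inP h1 /forall_inP h2 /forallP h3; exists c; split.
  - by move=> y z yH zH; move/forall_inP/(_ z zH)/implyP: (h1 y yH) => h /h/eqP.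
  - move=> y z yH zH ne zy; move/forall_inP/(_ z zH)/implyP: (h2 y yH); apply.
    by rewrite ne.
  - by move=> i y yH; move/forall_inP/(_ y yH)/implyP: (h3 i).
case=> h1 h2 h3; exists [ffun y => c y]; apply/and3P; split.
- by do 2!apply/forall_inP=> ? ?; apply/implyP=> ?; rewrite !ffunE; apply/eqP/h1.
- by do 2!apply/forall_inP=> ? ?; apply/implyP=> /andP[? ?]; rewrite !ffunE; apply: h2.
- by apply/forallP=> ?; apply/forall_inP=> ? ?; apply/implyP=> ?; rewrite ffunE; apply: h3.
Qed.

(** * Vertices, degrees and faces of the contracted graph *)

Section Contract.

Variables (I : gmap) (ab : I).
Local Notation bc := (face ab).
Local Notation cd := (face bc).
Local Notation ba := (edge ab).
Local Notation cb := (edge bc).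

Hypothesis edgeK : involutive (@edge I).
Hypothesis nodeI : injective (@node I).
Hypothesis deg_b : degree bc = 2.
Hypothesis deg_c : degree cd = 2.
Hypothesis b_c : vertex bc != vertex cd.

Lemma face_inj : injective (@face I).
Proof. by move=> y z /nodeI/(inv_inj edgeK). Qed.

(** By definition of [face], [node] sends [ba] to [bc], and at a vertex of degree 2 it is an
    involution. *)
Lemma node_b : node bc = ba.
Proof. by have [nn _ _] := degree2_node nodeI deg_b; apply: nodeI. Qed.

Lemma node_c : node cd = cb.
Proof. by have [nn _ _] := degree2_node nodeI deg_c; apply: nodeI. Qed.

Lemma vertex_b : vertex bc = [set bc; ba].
Proof. by have [_ _ ->] := degree2_node nodeI deg_b; rewrite node_b. Qed.

Lemma vertex_c : vertex cd = [set cd; cb].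
Proof. by have [_ _ ->] := degree2_node nodeI deg_c; rewrite node_c. Qed.

Lemma vertex_ba : vertex ba = [set bc; ba].
Proof. by rewrite -vertex_b; apply: vertex_eq => //; rewrite vertex_b set22. Qed.

Lemma vertex_cb : vertex cb = [set cd; cb].
Proof. by rewrite -vertex_c; apply: vertex_eq => //; rewrite vertex_c set22. Qed.

Lemma ba_bc : ba != bc.
Proof. by have [_ + _] := degree2_node nodeI deg_b; rewrite node_b. Qed.

Lemma cb_cd : cb != cd.
Proof. by have [_ + _] := degree2_node nodeI deg_c; rewrite node_c. Qed.

Lemma vertex_neq y z : y \in [set bc; ba] -> z \in [set cd; cb] -> y != z.
Proof.
rewrite -vertex_b -vertex_c => yb zc; apply: contraNneq b_c => E.
by rewrite -(vertex_eq nodeI yb) -(vertex_eq nodeI zc) E.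
Qed.

Lemma ba_cd : ba != cd. Proof. by rewrite vertex_neq ?set21 ?set22. Qed.
Lemma ba_cb : ba != cb. Proof. by rewrite vertex_neq ?set22. Qed.
Lemma bc_cd : bc != cd. Proof. by rewrite vertex_neq ?set21. Qed.

Let J := contract bc.
Implicit Types y z : J.

Lemma val_neq y : val y != bc /\ val y != cb.
Proof. by case/andP: (valP y). Qed.

(** [insubd] does not use its default: [edge] exchanges the two removed darts, so it leads no
    remaining dart to them. *)
Lemma val_edge y : val (edge y) = edge (val y).
Proof.
have [n1 n2] := val_neq y; rewrite /= val_insubd; case: ifP => // /negP[].
have e1 (u v : I) : (edge u == v) = (u == edge v) by rewrite -(inj_eq (inv_inj edgeK)) edgeK.
by rewrite !e1 edgeK n1 n2.
Qed.

(** The merged vertex keeps the darts [ba] and [cd]. Their successors [bc] and [cb] are removed, and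
    the redirection makes [node] exchange the two. *)
Lemma val_node y :
  val (node y) = if val y == ba then cd else if val y == cd then ba else node (val y).
Proof.
have [n1 n2] := val_neq y; rewrite /= val_insubd -[node (edge bc)]/cd node_b.
have eb (u : I) : (node u == bc) = (u == ba) by rewrite (inj_eq nodeI).
have ec (u : I) : (node u == cb) = (u == cd) by rewrite -node_c (inj_eq nodeI).
rewrite eb ec.
have [_|nba] := eqVneq (val y) ba; first by rewrite eq_sym bc_cd eq_sym cb_cd.
have [_|ncd] := eqVneq (val y) cd; first by rewrite ba_bc ba_cb.
by rewrite eb ec (negPf nba) (negPf ncd).
Qed.

Lemma mem_bc (u : I) : u \in [set bc; ba] -> u != bc -> u = ba.
Proof. by case/set2P=> -> //; rewrite eqxx. Qed.

Lemma vertex_contract y z :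
  (z \in vertex y) = if val y \in [set ba; cd] then val z \in [set ba; cd]
                     else val z \in vertex (val y).
Proof.
have nvb (u : J) : val u \in vertex bc -> val u = ba.
  by rewrite vertex_b => /mem_bc; apply; case: (val_neq u).
have nvc (u : J) : val u \in vertex cd -> val u = cd.
  by rewrite vertex_c => /set2P[] // E; case: (val_neq u); rewrite E eqxx.
have nba : val y \in [set ba; cd] -> val z \in [set ba; cd] -> z \in vertex y.
  move=> ym zm; have [<-|ne] := eqVneq y z; first exact: vertex_id.
  suff -> : z = node y by apply: vertex_node.
  apply: val_inj; rewrite val_node; move: ne; rewrite -val_eqE.
  case/set2P: ym zm => -> /set2P[]->; rewrite ?eqxx // => _.
  by rewrite eq_sym (negPf ba_cd).
case: ifP => ym.
  apply/idP/idP => [|/nba->//]; rewrite [z \in _]inE.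
  apply: (fconnect_closed (P := fun u : J => val u \in [set ba; cd])) => // u.
  by rewrite val_node => /set2P[]->; rewrite eqxx ?set22 // eq_sym (negPf ba_cd) set21.
have out (u : J) : val u \in vertex (val y) -> val u \notin [set ba; cd].
  move=> uy; apply: contraFN ym => /set2P[] E; move: uy; rewrite E => /(vertex_eq nodeI) vE.
    rewrite (nvb y) ?set21 // -(vertex_eq nodeI (_ : ba \in _)) ?vE ?vertex_id //.
    by rewrite vertex_b set22.
  by rewrite (nvc y) ?set22 // vE vertex_id.
have step (u : J) : val u \in vertex (val y) -> val (node u) = node (val u).
  by move/out; rewrite val_node !inE negb_or => /andP[/negPf-> /negPf->].
apply/idP/idP; first rewrite inE.
  apply: (fconnect_closed (P := fun u : J => val u \in vertex (val y))); last exact: vertex_id.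
  by move=> u uy; rewrite step // -(vertex_eq nodeI uy) vertex_node.
rewrite inE => /iter_findex; move: (findex _ _ _) => k E.
have K i : val (iter i node y) = iter i node (val y).
  elim: i => [//|i IH]; rewrite !iterS -IH -step // IH inE fconnect_iter //.
suff -> : z = iter k node y by rewrite inE fconnect_iter.
by apply: val_inj; rewrite K.
Qed.

Lemma vertex_contract_imset y : val y \notin [set ba; cd] ->
  val @: vertex y = vertex (val y).
Proof.
move=> yn; apply/setP=> u; apply/imsetP/idP=> [[z + ->]|uy].
  by rewrite vertex_contract (negPf yn).
have un : (u != bc) && (u != cb).
  have yu : val y \in vertex u by rewrite (vertex_eq nodeI uy) vertex_id.
  have [n1 n2] := val_neq y.
  apply/andP; split; apply: contra yn => /eqP E; move: yu; rewrite E.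
    by rewrite vertex_b => /mem_bc/(_ n1)->; rewrite set21.
  rewrite vertex_cb => /set2P[->|E'].
    by rewrite set22.
  by rewrite E' eqxx in n2.
by exists (Sub u un) => //; rewrite vertex_contract (negPf yn).
Qed.

Lemma degree_val_special y : val y \in [set ba; cd] -> degree (val y) = 2.
Proof.
case/set2P=> -> //; by rewrite /degree vertex_ba -vertex_b.
Qed.

Lemma ba_in : (ba != bc) && (ba != cb). Proof. by rewrite ba_bc ba_cb. Qed.
Lemma cd_in : (cd != bc) && (cd != cb).
Proof. by rewrite ![cd == _]eq_sym bc_cd cb_cd. Qed.
(* The two darts of the merged vertex. *)
Definition baJ : J := Sub ba ba_in.
Definition cdJ : J := Sub cd cd_in.

Lemma degree_contract y : degree y = degree (val y).
Proof.
have [ym|yn] := boolP (val y \in [set ba; cd]).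
  rewrite degree_val_special // /degree.
  have -> : vertex y = [set baJ; cdJ].
    by apply/setP=> z; rewrite vertex_contract ym !inE -!val_eqE.
  by rewrite cards2 -val_eqE /= ba_cd.
by rewrite /degree -vertex_contract_imset // card_imset //; apply: val_inj.
Qed.

(** [node] was redirected only at [ba] and [cd], where the next dart in [I] would be [bc] or [cb].
    So a face walk that meets neither of these is unchanged. *)
Lemma face_contract y z : face (val y) = val z -> face y = z.
Proof.
move=> E; apply: val_inj; rewrite /face val_node val_edge; have [n1 n2] := val_neq z.
case: eqP => [F|_]; first by rewrite -E /face F eqxx in n1.
by case: eqP => [F|_ //]; rewrite -E /face F node_c eqxx in n2.
Qed.

Lemma face_contract_ab y : val y = ab -> face y = cdJ.
Proof. by move=> E; apply: val_inj; rewrite /face val_node val_edge E eqxx. Qed.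

Lemma seq_val (s : seq I) : bc \notin s -> cb \notin s -> exists t : seq J, map val t = s.
Proof.
elim: s => [|u s IH]; first by exists [::].
rewrite !inE !negb_or => /andP[u1 s1] /andP[u2 s2]; have [t <-] := IH s1 s2.
have uP : (u != bc) && (u != cb) by rewrite ![u == _]eq_sym u1 u2.
by exists (Sub u uP :: t).
Qed.

Lemma path_contract y (t : seq J) :
  path (frel (@face _)) (val y) (map val t) -> path (frel (@face _)) y t.
Proof.
elim: t y => //= z t IH y /andP[/eqP E p]; rewrite IH // andbT.
by apply/eqP; apply: face_contract.
Qed.

Lemma contracted_out (u : I) :
  u \notin vertex bc :|: vertex cd -> exists2 y : J, u = val y & val y \notin [set ba; cd].
Proof.
rewrite vertex_b vertex_c !inE !negb_or => /andP[/andP[n1 n2] /andP[n3 n4]].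
have uP : (u != bc) && (u != cb) by rewrite n1.
by exists (Sub u uP); rewrite //= !inE negb_or n2.
Qed.

(** * The contraction set and its reduced graph, carried over to [J] *)

Section ContractionSet.

Variable X : {set I}.
Hypothesis X_contr : contraction_set X.

Definition contracted_set : {set J} := [set y | val y \in X].
Local Notation XJ := contracted_set.

Lemma vertex_bI : vertex bc :&: X = set0.
Proof.
apply/setP=> u; rewrite !inE; apply/negP=> /andP[ub uX]; have [_ _ d3 _] := X_contr.
by have := d3 u uX; rewrite /degree (vertex_eq nodeI (_ : u \in vertex bc)) ?inE // -/(degree _) deg_b.
Qed.

Lemma vertex_cI : vertex cd :&: X = set0.
Proof.
apply/setP=> u; rewrite !inE; apply/negP=> /andP[ub uX]; have [_ _ d3 _] := X_contr.
by have := d3 u uX; rewrite /degree (vertex_eq nodeI (_ : u \in vertex cd)) ?inE // -/(degree _) deg_c.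
Qed.

Lemma notin_X u : u \in vertex bc :|: vertex cd -> u \notin X.
Proof.
move=> uv; apply/negP=> uX; have: u \in (vertex bc :|: vertex cd) :&: X by rewrite inE uv.
by rewrite setIUl vertex_bI vertex_cI setU0 inE.
Qed.

Lemma special_vertex u : u \in [set ba; cd] -> vertex u :&: X = set0.
Proof. by case/set2P=> ->; rewrite ?vertex_cI // vertex_ba -vertex_b vertex_bI. Qed.

Lemma vertex_contractI y : val @: (vertex y :&: XJ) = vertex (val y) :&: X.
Proof.
have [ym|yn] := boolP (val y \in [set ba; cd]).
  rewrite special_vertex //; apply/setP=> u; rewrite inE; apply/imsetP=> -[z].
  rewrite in_setI vertex_contract ym => /andP[zm]; rewrite inE => zX _.
  suff: val z \in vertex (val z) :&: X by rewrite special_vertex // inE.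
  by rewrite in_setI vertex_id.
rewrite -vertex_contract_imset //; apply/setP=> u; apply/imsetP/idP=> [[z]|].
  by rewrite !inE => /andP[zy zX] ->; rewrite zX imset_f // inE.
by case/setIP=> /imsetP[z zy ->] zX; exists z; rewrite // inE zy inE.
Qed.

Lemma vertex_contractD y : val y \notin [set ba; cd] ->
  val @: (vertex y :\: XJ) = vertex (val y) :\: X.
Proof.
move=> yn; rewrite -vertex_contract_imset //; apply/setP=> u; apply/imsetP/idP=> [[z]|].
  by rewrite !inE => /andP[zX zy] ->; rewrite zX imset_f // inE.
by case/setDP=> /imsetP[z zy ->] zX; exists z; rewrite // inE zy inE zX.
Qed.

Lemma suppressed_special u : u \in vertex bc :|: vertex cd -> suppressed X u = false.
Proof.
by rewrite /suppressed => /setUP[] /(vertex_eq nodeI)->; rewrite ?vertex_bI ?vertex_cI eqxx.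
Qed.

Lemma special_sub u : u \in [set ba; cd] -> u \in vertex bc :|: vertex cd.
Proof. by rewrite vertex_b vertex_c !inE; case/orP=> ->; rewrite ?orbT. Qed.

Lemma suppressed_contract y : suppressed XJ y = suppressed X (val y).
Proof.
have eI : (vertex y :&: XJ == set0) = (vertex (val y) :&: X == set0).
  by rewrite -vertex_contractI imset_eq0.
have [ym|yn] := boolP (val y \in [set ba; cd]).
  by rewrite (suppressed_special (special_sub ym)) /suppressed eI special_vertex // eqxx.
by rewrite /suppressed eI -vertex_contractD // (card_imset _ val_inj).
Qed.

Lemma contraction_set_contract : contraction_set XJ.
Proof.
have [X0 eX d3 n2] := X_contr; split.
- have [u uX] := set0Pn _ X0.
  have [|y uE _] := contracted_out (u := u).
    by apply: contraL uX => /notin_X.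
  by apply/set0Pn; exists y; rewrite inE -uE.
- by move=> y; rewrite !inE val_edge eX.
- by move=> y; rewrite inE degree_contract; apply: d3.
- by move=> y; rewrite -(card_imset _ val_inj) vertex_contractI.
Qed.

Lemma reduced_darts_contract y : (y \in reduced_darts XJ) = (val y \in reduced_darts X).
Proof. by rewrite !inE suppressed_contract. Qed.

(** The vertices [b] and [c] do not meet [X] and so are not suppressed. Hence [bc] is an entire
    chain by itself, and any other chain avoids both of its darts and lifts step by step to [J]. *)
Lemma reduced_same_contract u v : reduced_same X u v ->
  u \in [set bc; cb] /\ v \in [set bc; cb] \/
  exists y z : J, [/\ u = val y, v = val z & reduced_same XJ y z].
Proof.
have bcv : bc \in vertex bc :|: vertex cd by rewrite inE vertex_id.
have cbv : cb \in vertex bc :|: vertex cd by rewrite vertex_c !inE eqxx !orbT.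
have eE (s t : I) : (edge s == t) = (s == edge t) by rewrite -(inj_eq (inv_inj edgeK)) edgeK.
move=> uv; apply: (connect_invariant (P := fun w => u \in [set bc; cb] /\ w \in [set bc; cb] \/
  exists y z : J, [/\ u = val y, w = val z & reduced_same XJ y z]) _ _ (uv : connect _ u v));
    last first.
  have [um|un] := boolP (u \in [set bc; cb]); [by left | right].
  have uP : (u != bc) && (u != cb) by rewrite !inE negb_or in un.
  by exists (Sub u uP), (Sub u uP); split=> //; apply: connect0.
move=> s t [[um sm] /and3P[_ _ st]|[y [z [-> -> yz]]] /and3P[zX tX st]].
  left; split=> //; case/orP: st => [/eqP->|].
    by case/set2P: sm => ->; rewrite ?edgeK ?set21 ?set22.
  by case/set2P: sm => ->; rewrite suppressed_special.
right; have tP : (t != bc) && (t != cb).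
  have [n1 n2] := val_neq z; case/orP: st => [/eqP->|/andP[sz tz]].
    by rewrite !eE edgeK n1 n2.
  have : suppressed X t by rewrite /suppressed (vertex_eq nodeI tz).
  by move=> sX; apply/andP; split; apply: contraTneq sX => ->; rewrite suppressed_special.
exists y, (Sub t tP); split=> //; apply: connect_trans yz _; apply: connect1.
apply/and3P; split; [by rewrite inE | by rewrite inE | apply/orP].
case/orP: st => [/eqP tE|/andP[sz tz]]; [left | right].
  by rewrite -val_eqE val_edge /= tE.
rewrite suppressed_contract sz vertex_contract; case: ifP => // zm.
by rewrite suppressed_special ?special_sub in sz.
Qed.

End ContractionSet.

(** * Passing colorings and reducibility between [I] and [J] *)

Section Transfer.

Variables (o : I) (o' : J).
Variables (h : 'I_(size (ring o')) -> 'I_(size (ring o))).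
Variables (b : 'I_(size (ring o))) (i0 : 'I_(size (ring o'))).
Hypothesis S : splits h b i0.
Hypothesis db : ring_dart b = bc.
Hypothesis d0 : val (ring_dart i0) = cd.
Hypothesis dh : forall i, ring_dart (h i) = val (ring_dart i).
Hypothesis dn : forall i, i != i0 -> val (ring_dart i) \notin vertex bc :|: vertex cd.

Lemma dn_special i : i != i0 -> val (ring_dart i) \notin [set ba; cd].
Proof.
by move/dn; rewrite vertex_b vertex_c !inE !negb_or => /andP[/andP[_ ->] /andP[-> _]].
Qed.

Lemma extendable_merge kappa :
  kappa \in extendable o -> kappa b != kappa (h i0) -> merge_ring h b i0 kappa \in extendable o'.
Proof.
case/restrictionsP=> c [h1 h2 h3] ne.
have cbe : c cb = c bc by apply/esym/h1; rewrite ?in_setT //=.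
have n1 : c bc != c ba by apply: h2; rewrite ?in_setT ?ba_bc ?vertex_b ?set22.
have n2 : c cb != c cd by rewrite eq_sym; apply: h2; rewrite ?in_setT ?cb_cd ?vertex_c ?set22.
have kb u : u \in vertex bc -> c u != kappa b by move=> uv; apply: h3; rewrite ?db ?in_setT.
have kc u : u \in vertex cd -> c u != kappa (h i0).
  by move=> uv; apply: h3; rewrite ?dh ?d0 // in_setT.
have b1 : c bc != kappa b by apply: kb; rewrite vertex_b set21.
have b2 : c ba != kappa b by apply: kb; rewrite vertex_b set22.
have c1 : c cb != kappa (h i0) by apply: kc; rewrite vertex_c set22.
have c2 : c cd != kappa (h i0) by apply: kc; rewrite vertex_c set21.
rewrite cbe in n2 c1.
have tE : third (kappa b) (kappa (h i0)) = c bc by apply: thirdE.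
(* The ring edge at [b] has the third color besides [bc] and [ab], and the one at [c] the third
   color besides [bc] and [cd]. If [ab] and [cd] had equal colors, so would the two ring edges. *)
have ac : c ba != c cd.
  apply: contraNneq ne => E; apply/eqP; transitivity (third (c bc) (c ba)).
    by apply/esym/thirdE; rewrite // eq_sym.
  by apply: thirdE; rewrite // eq_sym // E.
apply/restrictionsP; exists (fun y => c (val y)); split.
- by move=> y z _ _ /eqP->; rewrite val_edge; apply: h1; rewrite ?in_setT /=.
- move=> y z _ _; rewrite vertex_contract -val_eqE; case: ifP => [|_ zy yz]; last first.
    by apply: h2; rewrite ?in_setT.
  by case/set2P=> -> nzy /set2P[] zE; move: nzy; rewrite zE ?eqxx // => _; rewrite eq_sym.
- move=> i y _; rewrite vertex_contract ffunE; have [->|ni] := eqVneq i i0.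
    by rewrite d0 set22 tE => /set2P[]->; rewrite eq_sym.
  by rewrite (negPf (dn_special ni)) -dh => yv; apply: h3; rewrite ?in_setT.
Qed.

Lemma restrictions_split (X : {set I}) kappa' : contraction_set X ->
  kappa' \in restrictions o' (reduced_darts (contracted_set X)) (reduced_same (contracted_set X)) ->
  exists kappa : coloring (size (ring o)), [/\ kappa b != kappa (h i0),
    merge_ring h b i0 kappa = kappa' &
    kappa \in restrictions o (reduced_darts X) (reduced_same X)].
Proof.
move=> Xc; case/restrictionsP=> c [h1 h2 h3]; set XJ := contracted_set X in h1 h2 h3.
have inH u : u \in vertex bc :|: vertex cd -> u \in reduced_darts X.
  by move=> uv; rewrite inE suppressed_special // notin_X.
have baH : baJ \in reduced_darts XJ.
  by rewrite (reduced_darts_contract Xc) inH // vertex_b !inE eqxx orbT.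
have cdH : cdJ \in reduced_darts XJ by rewrite (reduced_darts_contract Xc) inH // inE vertex_id orbT.
have sp (y : J) : val y \in [set ba; cd] -> y \in vertex (ring_dart i0).
  by rewrite vertex_contract d0 set22.
have nab : c baJ != c cdJ.
  apply: h2 => //; last by rewrite vertex_contract set21 set22.
  by rewrite -val_eqE /= eq_sym ba_cd.
have nba : c baJ != kappa' i0 by apply: h3 => //; apply: sp; apply: set21.
have ncd : c cdJ != kappa' i0 by apply: h3 => //; apply: sp; apply: set22.
(* The colors are assigned crosswise: the ring edge at [b] gets the color of [cd], and the one at
   [c] that of [ab]. *)
have [|kappa [kb kc kh km]] := merge_onto (kappa := kappa') (x := c cdJ) (y := c baJ) S.
  by apply: thirdE; rewrite // eq_sym.
have kbc : kappa b != kappa (h i0) by rewrite kb kc eq_sym.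
exists kappa; split=> //.
pose d (u : I) := if u \in [set bc; cb] then kappa' i0 else c (insubd o' u).
have dV (y : J) : d (val y) = c y.
  have [n1 n2] := val_neq y; rewrite /d !inE (negPf n1) (negPf n2) /=.
  by rewrite valKd.
have dbc : d bc = kappa' i0 by rewrite /d set21.
have dcb : d cb = kappa' i0 by rewrite /d set22.
have dba : d ba = c baJ by rewrite -dV.
have dcd : d cd = c cdJ by rewrite -dV.
apply/restrictionsP; exists d; split.
- move=> u v uH vH /(reduced_same_contract Xc)[[um vm]|[y [z [uE vE yz]]]].
    by rewrite /d um vm.
  by rewrite uE vE !dV; apply: h1 yz; rewrite (reduced_darts_contract Xc) -?uE -?vE.
- move=> u v uH vH nvu; have [uv|un] := boolP (u \in vertex bc :|: vertex cd).
    case/setUP: uv => uv; rewrite (vertex_eq nodeI uv).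
      by move: uv nvu; rewrite vertex_b => /set2P[]-> nvu /set2P[] E; move: nvu;
        rewrite E ?eqxx // => _; rewrite dbc dba // eq_sym.
    by move: uv nvu; rewrite vertex_c => /set2P[]-> nvu /set2P[] E; move: nvu;
        rewrite E ?eqxx // => _; rewrite dcb dcd // eq_sym.
  move=> vu; have vn : v \notin vertex bc :|: vertex cd.
    by apply: contra un => /setUP[] H; apply/setUP; [left|right];
       rewrite -(vertex_eq nodeI H) (vertex_eq nodeI vu) vertex_id.
  have [y uE yn] := contracted_out un; have [z vE _] := contracted_out vn.
  rewrite uE vE !dV; apply: h2; rewrite ?(reduced_darts_contract Xc) -?uE -?vE //.
    by rewrite -val_eqE /= -uE -vE.
  by rewrite vertex_contract (negPf yn) -uE -vE.
- move=> e u uH; have [->|ne] := eqVneq e b.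
    by rewrite db vertex_b kb => /set2P[]->; rewrite ?dbc ?dba // eq_sym.
  have [_ _ ho _] := S; have [i ->] := ho e ne; have [->|ni] := eqVneq i i0.
    by rewrite dh d0 vertex_c kc => /set2P[]->; rewrite ?dcb ?dcd // eq_sym.
  rewrite dh kh // => uv; have un : u \notin vertex bc :|: vertex cd.
    by apply: contra (dn ni) => /setUP[] H; apply/setUP; [left|right];
       rewrite -(vertex_eq nodeI H) (vertex_eq nodeI uv) vertex_id.
  have [y uE _] := contracted_out un; rewrite uE dV; apply: h3.
    by rewrite (reduced_darts_contract Xc) -uE.
  by rewrite vertex_contract (negPf (dn_special ni)) -uE.
Qed.

Lemma critical_merge (kappa : coloring (size (ring o))) :
  kappa b != kappa (h i0) -> merge_ring h b i0 kappa \in critical o' -> kappa \in critical o.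
Proof. by apply: max_consistent_split S _ => kp; apply: extendable_merge. Qed.

Lemma D_reducible_contract : D_reducible o -> D_reducible o'.
Proof.
rewrite /D_reducible => Do; apply/setP=> kappa'; rewrite inE; apply/negP=> k'.
(* The two colors other than [a], namely [x] and [third a x], are given to the two ring edges that
   replace [i0]. *)
pose a := kappa' i0; pose x := third a a; have /andP[xa _] : (x != a) && (x != a) := third_neq a a.
have /andP[ya yx] := third_neq a x.
have [|kappa [kb kc _ km]] := merge_onto (kappa := kappa') (x := x) (y := third a x) S.
  by apply: thirdE; rewrite // eq_sym.
have : kappa \in critical o by apply: critical_merge; rewrite ?km // kb kc eq_sym.
by rewrite Do inE.
Qed.

Lemma C_reducible_contract X : C_reducible_with o X -> C_reducible o'.
Proof.
case=> Xc disj; exists (contracted_set X); split; first exact: contraction_set_contract.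
apply/setP=> kappa'; rewrite in_setI in_set0; apply/negP=> /andP[/(restrictions_split Xc)].
case=> kappa [ne km kX] kc.
have: kappa \in critical o by apply: critical_merge; rewrite ?km.
by move=> ko; have := in_set0 kappa; rewrite -disj in_setI kX ko.
Qed.

End Transfer.

(** * The infinite face and the ring after the contraction *)

Section Outer.

Hypothesis outer_cb : ~~ fconnect (@face _) bc cb.

(** The face walk [bc, cd, ...] ends at [ab]. By [outer_cb] it does not contain [cb], so it loses
    only [bc], and in [J] it closes up from [ab] to [cd]. The rotation accounts for the arbitrary
    starting dart [o']. *)
Lemma orbit_contract (o' : J) : fconnect (@face _) bc (val o') ->
  exists j s, [/\ uniq (bc :: cd :: s), orbit (@face _) bc = bc :: cd :: s &
    map val (orbit (@face _) o') = rot j (cd :: s)].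
Proof.
move=> oo'; have := cycle_orbit face_inj bc; have := orbit_uniq (@face _) bc.
have : forall u, u \in orbit (@face _) bc -> fconnect (@face _) bc u.
  by move=> u; rewrite -fconnect_orbit.
have : val o' \in orbit (@face _) bc by rewrite -fconnect_orbit.
have : orbit (@face _) bc = bc :: behead (orbit (@face _) bc) by rewrite /orbit -orderSpred.
case: (behead _) => [|u s] -> oin sub us /= /andP[/eqP fb].
  by move: bc_cd; rewrite fb eqxx.
rewrite -{}fb in oin sub us *; rewrite rcons_path => /andP[p /eqP fl].
have us1 : uniq (cd :: s) by case/andP: us.
have bs : bc \notin cd :: s by case/andP: us.
have cs : cb \notin cd :: s.
  by apply: contra outer_cb => h; apply: sub; rewrite inE h orbT.
have [t tE] := seq_val bs cs.
case: t tE => // c t [cE tE].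
have {}cE : val c = cd := cE; have {}tE : map val t = s := tE.
have ct : fcycle (@face _) (c :: t).
  have lE : val (last c t) = ab by apply: face_inj; rewrite -last_map tE cE.
  have p' : path (frel (@face _)) c t by apply: path_contract; rewrite cE tE.
  rewrite [fcycle _ _]rcons_path p'; apply/eqP; apply: etrans (face_contract_ab lE) _.
  by apply: val_inj; rewrite cE.
have mE : map val (c :: t) = cd :: s by rewrite map_cons cE tE.
have ut : uniq (c :: t) by rewrite -(map_inj_uniq val_inj) mE.
have ot : o' \in c :: t.
  rewrite -(mem_map val_inj) mE; move: oin; rewrite inE => /orP[/eqP E|//].
  by case: (val_neq o'); rewrite E eqxx.
exists (index o' (c :: t)), s; split=> //.
by rewrite (fingraph.orbitE ct ut ot) map_rot mE.
Qed.

Lemma ring_contract (o : I) (o' : J) :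
  fconnect (@face _) o bc -> fconnect (@face _) o (val o') ->
  exists j j' s, [/\ uniq (bc :: cd :: s), ring o = rot j (bc :: cd :: s),
     map val (ring o') = rot j' (cd :: s) & ba \notin s /\ cb \notin s].
Proof.
move=> ob oo'; have sym := fconnect_sym face_inj.
have bo' : fconnect (@face _) bc (val o') by apply: connect_trans oo'; rewrite sym.
have [i [s [us bE o'E]]] := orbit_contract bo'.
have oE : orbit (@face _) o = rot (index o (orbit (@face _) bc)) (orbit (@face _) bc).
  apply: (fingraph.orbitE (cycle_orbit face_inj bc) (orbit_uniq (@face _) bc)).
  by rewrite -fconnect_orbit sym.
rewrite bE in oE; rewrite /ring oE.
have [j ->] := filter_rot (fun u : I => degree u == 2) (bc :: cd :: s) (index o (bc :: cd :: s)).
have [j' jE] := filter_rot (fun u : I => degree u == 2) (cd :: s) i.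
exists j, j', (filter (fun u : I => degree u == 2) s).
have sub u : u \in s -> fconnect (@face _) bc u.
  by move=> us'; rewrite fconnect_orbit bE !inE us' !orbT.
split.
- move: us; rewrite /= !inE !mem_filter !negb_or !negb_and => /and3P[/andP[-> ->] -> us].
  by rewrite !orbT filter_uniq.
- by rewrite /= deg_b deg_c.
- have -> : cd :: [seq u <- s | degree u == 2] = [seq u <- cd :: s | degree u == 2].
    by rewrite /= deg_c.
  rewrite -jE -o'E.
  rewrite filter_map; congr map; apply: eq_filter => y /=.
  by rewrite degree_contract.
(* Since [ba] follows [cb] on its face, both lie on the side of [bc] that is not the infinite
   face. *)
- rewrite !mem_filter; split; apply: contra outer_cb => /andP[_ /sub].
    have E : face cb = ba by rewrite /face edgeK node_b.
    by move/connect_trans; apply; rewrite sym -E fconnect1.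
  by [].
Qed.


Lemma ring_dart_embedding (o : I) (o' : J) :
  fconnect (@face _) o bc -> fconnect (@face _) o (val o') ->
  exists (h : 'I_(size (ring o')) -> 'I_(size (ring o))) b i0,
    [/\ splits h b i0, ring_dart b = bc, val (ring_dart i0) = cd,
      forall i, ring_dart (h i) = val (ring_dart i) &
      forall i, i != i0 -> val (ring_dart i) \notin vertex bc :|: vertex cd].
Proof.
move=> ob oo'; have [j [j' [s [us rE r'E [bas cbs]]]]] := ring_contract ob oo'.
have ur' : uniq (map val (ring o')) by rewrite r'E rot_uniq; case/andP: us.
have dE (i : 'I_(size (ring o))) : ring_dart i = nth bc (ring o) i by apply: tnth_nth.
have d'E (i : 'I_(size (ring o'))) : val (ring_dart i) = nth bc (map val (ring o')) i.
  by rewrite /ring_dart (tnth_nth o') (nth_map o').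
have mem' (i : 'I_(size (ring o'))) : val (ring_dart i) \in cd :: s.
  by rewrite d'E -(mem_rot j') -r'E mem_nth // size_map.
have mem (i : 'I_(size (ring o'))) : val (ring_dart i) \in ring o.
  by rewrite rE mem_rot inE mem' orbT.
have lt u : u \in ring o -> index u (ring o) < size (ring o) by rewrite index_mem.
have bR : bc \in ring o by rewrite rE mem_rot mem_head.
have lt0 : index cd (map val (ring o')) < size (ring o').
  by rewrite -(size_map val) index_mem r'E mem_rot mem_head.
(* [h] sends the position of a dart in the ring of [J] to its position in the ring of [I]. The
   left-out edge is at [bc], and the merged ring edge is the one listed by [cd]. *)
exists (fun i => Ordinal (lt _ (mem i))), (Ordinal (lt _ bR)), (Ordinal lt0).
have d0 : val (ring_dart (Ordinal lt0)) = cd.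
  by rewrite d'E nth_index // r'E mem_rot mem_head.
split=> //.
- apply: (rot_splits _ _ us rE r'E) => //.
  + by rewrite size_map.
  + by move=> i; rewrite -d'E nth_index.
  + by rewrite nth_index.
  + by rewrite -d'E.
- by rewrite dE nth_index.
- by move=> i; rewrite dE nth_index.
- move=> i ni; have nd : val (ring_dart i) != cd.
    rewrite -d0 !d'E nth_uniq ?size_map //.
  have [n1 n2] := val_neq (ring_dart i).
  have nb : val (ring_dart i) != ba.
    apply: contraNneq bas => <-; have := mem' i.
    by rewrite inE (negPf nd).
  by rewrite vertex_b vertex_c !inE (negPf n1) (negPf nb) (negPf nd) (negPf n2).
Qed.

End Outer.

End Contract.

(** Since the deletion of the vertex [b] leaves the graph connected, the edge [ab] is not a bridge:
    [b] is still reached through [bc]. So [not_bridge] applies to [ab], and the faces beside [ab]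
    are those beside [bc]. *)
Lemma outer_edge_sides (G : gmap) (o ab : G) :
  island o -> degree (face ab) = 2 -> vertex ab != vertex (face ab) ->
  vertex (face ab) != vertex (face (face ab)) ->
  ~~ fconnect (@face G) (face ab) (edge (face ab)).
Proof.
case=> pG [_ _ conn] _ _ d2 ab_b b_c; have [[edgeK edgeN] nodeI _ _] := pG.
set bc := face ab in d2 ab_b b_c *; set cb := edge bc.
have nb : node bc = edge ab := node_b nodeI d2.
have vb : vertex bc = [set bc; edge ab] := vertex_b nodeI d2.
have sym := fconnect_sym (face_inj edgeK nodeI).
(* The face walks lead from [ab] to [bc] and from [cb] to the reverse of [ab], so a common face of
   the two sides of [bc] would be one for [ab]. *)
suff: ~~ fconnect (@face G) ab (edge ab).
  apply: contra => bcb; have <- : face cb = edge ab by rewrite /face edgeK nb.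
  by apply: connect_trans (connect_trans (fconnect1 _ ab) bcb) (fconnect1 _ _).
have out u : vertex u != vertex bc -> u \notin vertex bc.
  by move=> ne; apply: contra ne => /(vertex_eq nodeI)->.
have ab_out : ab \notin vertex bc by apply: out.
have cb_out : cb \notin vertex bc.
  apply: out; rewrite eq_sym; apply: contraNneq b_c => ->.
  by rewrite eq_sym; apply/eqP/vertex_eq => //; apply: vertex_node.
pose e := [rel s t : G | (t == node s) || (s \notin [set ab; edge ab]) && (t == edge s)].
have e_out u : u \notin vertex bc -> connect e ab u.
  move=> un; apply: connect_sub (conn bc ab u ab_out un) => s t /and3P[sn tn].
  case/orP=> /eqP E; apply: connect1; rewrite /= E eqxx ?orbT // andbT !inE negb_or.
  apply/orP; right; apply/andP; split.
    by apply: contraNneq tn => F; rewrite E F vb set22.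
  by apply: contraNneq sn => ->; rewrite vb set22.
apply: not_bridge => // y; have [|/e_out//] := boolP (y \in vertex bc).
have cbc : connect e ab bc.
  apply: connect_trans (e_out _ cb_out) (connect1 _); rewrite /= edgeK eqxx andbT !inE negb_or.
  apply/orP; right; apply/andP; split.
    by apply: contraNneq (ba_bc nodeI d2) => E; rewrite -(inj_eq (inv_inj edgeK)) edgeK -/bc -/cb E.
  by apply: contraNneq cb_out => ->; rewrite vb set22.
by rewrite vb => /set2P[]-> //; apply: connect_trans cbc (connect1 _); rewrite /= nb eqxx.
Qed.

Theorem theoremD2 (I : gmap) (o : I) (ab bc cd : I) (o' : contract bc)
  (I_island : island o)
  (ab_outer : fconnect (@face I) o ab)
  (bc_next : bc = face ab)
  (cd_next : cd = face bc)
  (abcd_path : uniq [:: vertex ab; vertex bc; vertex cd; vertex (edge cd)])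
  (b_deg2 : degree bc = 2)
  (c_deg2 : degree cd = 2)
  (o'_outer : fconnect (@face I) o (contract_dart o'))
  (I_reducible : reducible o)
  (I_only_C : ~ D_reducible o ->
     exists X : {set I},
       [/\ C_reducible_with o X, ~ (ab \in X /\ cd \in X) &
           ~ isolated_after X bc]) :
  reducible o'.
Proof.
subst bc cd; have [[[edgeK edgeN] nodeI _ _] _ _ _] := I_island.
have /and3P[] : uniq [:: vertex ab; vertex (face ab); vertex (face (face ab))].
  by move: abcd_path; rewrite -[_ :: _]/([:: _; _; _] ++ [:: _]) cat_uniq => /andP[].
rewrite !inE negb_or => /andP[ab_b _] b_c _.
have out := outer_edge_sides I_island b_deg2 ab_b b_c.
have ob : fconnect (@face I) o (face ab) := connect_trans ab_outer (fconnect1 _ _).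
have [h [b [i0 [S db d0 dh dn]]]] :=
  ring_dart_embedding edgeK nodeI b_deg2 c_deg2 b_c out ob o'_outer.
(* D-reducibility is an equation between finite sets, hence decidable; when it fails, [I_only_C]
   provides the contraction set. *)
have [/eqP Do|/eqP nDo] := boolP (critical o == set0).
  left; apply: (D_reducible_contract _ _ _ _ _ S db d0 dh dn) => //.
have [X [CX _ _]] := I_only_C nDo.
by right; apply: (C_reducible_contract _ _ _ _ _ S db d0 dh dn CX).
Qed.
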